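(* There exist universal constants $0<a_1\le a_2$, $0<b_1\le b_2$ and $c_0>0$ (independent of $n,d,\mu,L,\sigma,c_*$, of the functions $f_i$, of the noise, of the network and of the algorithm parameters) such that the following holds. Suppose the functions $f_1,\dots,f_n:\mathbb{R}^d\to\mathbb{R}$ satisfy the function and heterogeneity assumptions (constants $\mu,L,c_*$), the gradient noise satisfies the noise assumption (constant $\sigma$), and the mixing matrix $\boldsymbol{W}$ satisfies the network assumption, as given in the context. Let $\kappa=L/\mu$, and take $$\varphi_t=\frac{c_\varphi}{\sqrt{t+1}},\quad \epsilon_t=\tau(t+1)^{3/5},\quad \beta_t=\frac{c_\beta}{\sqrt{t+1}},\quad \eta_t=\frac{c_\eta}{(t+1)^{1/5}},$$ with constants $c_\varphi,\tau,c_\eta>0$ and $0\le c_\beta<1$ satisfying $$a_1\frac{\sigma^2}{\mu^2}\le c_\eta^2c_\varphi^2\le a_2\frac{\sigma^2}{\mu^2},\qquad b_1\, d\,\sigma^2\kappa^{5/2}\le\tau\le b_2\, d\,\sigma^2\kappa^{5/2}.$$ Then there exists a constant $c_s\ge c_0\, d^{-1/2}\kappa^{-5/4}$ such that, for each $i\in\{1,\dots,n\}$, the iterates $\{\boldsymbol{x}_i^t\}$ of the algorithm SClip-EF-Network satisfy, for every $0<\delta<\min(c_s,2/5)$, $$\lim_{t\to\infty}(t+1)^{\delta}\,\mathbb{E}\big[\|\boldsymbol{x}_i^t-\boldsymbol{x}^*\|^2\big]=0 .$$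
   Context: Function assumption: each $f_i:\mathbb{R}^d\to\mathbb{R}$, $i=1,\dots,n$, is twice continuously differentiable with $\mu\boldsymbol{I}\preceq\nabla^2f_i(\boldsymbol{x})\preceq L\boldsymbol{I}$ for all $\boldsymbol{x}$, where $L\ge\mu>0$. Set $f=\frac1n\sum_{i=1}^nf_i$ and $\boldsymbol{x}^*=\arg\min_{\boldsymbol{x}\in\mathbb{R}^d} f(\boldsymbol{x})$. Heterogeneity assumption: $\|\nabla f_i(\boldsymbol{x}^* )\|_\infty\le c_*$ for all $i$. Noise assumption: querying node $i$'s oracle at iteration $t$ at the point $\boldsymbol{x}_i^t$ returns $g_i(\boldsymbol{x}_i^t)=\nabla f_i(\boldsymbol{x}_i^t)+\boldsymbol{\xi}_i^t$. The families $\{\boldsymbol{\xi}_i^t\}_{i=1}^n$ are independent over $t\ge0$. Every component of every $\boldsymbol{\xi}_i^t\in\mathbb{R}^d$ has the same marginal probability density $p:\mathbb{R}\to[0,\infty)$, with $p(u)=p(-u)$ for all $u$ and $\int_{-\infty}^\infty|u|p(u)\,du\le\sigma$ for a constant $\sigma>0$. (No higher moment is assumed.) Network assumption: the nodes $1,\dots,n$ form a directed, strongly connected communication network; $\boldsymbol{W}=(w_{ij})\in\mathbb{R}^{n\times n}$ is entrywise nonnegative, $w_{ij}\ne0$ only if $i=j$ or there is a communication link between $i$ and $j$; $\boldsymbol{W}$ is doubly stochastic ($\boldsymbol{W}\mathbf{1}=\mathbf{1}$, $\mathbf{1}^\top\boldsymbol{W}=\mathbf{1}^\top$); and $\lambda:=\|\boldsymbol{W}-\frac1n\mathbf{1}\mathbf{1}^\top\|_2\in[0,1)$.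 Smooth clipping: $\Psi_t(y)=\dfrac{y\,\varphi_t}{\sqrt{y^2+\epsilon_t}}$ for $y\in\mathbb{R}$, and $\boldsymbol{\Psi}_t$ applies $\Psi_t$ to each component of a vector in $\mathbb{R}^d$. Algorithm SClip-EF-Network: start from a deterministic common point $\boldsymbol{x}_1^0=\dots=\boldsymbol{x}_n^0$ and $\boldsymbol{m}_i^0=\mathbf{0}$; for $t=0,1,2,\dots$ and each $i$, $$\boldsymbol{m}_i^{t+1}=\beta_t\boldsymbol{m}_i^t+(1-\beta_t)\boldsymbol{\Psi}_t\big(g_i(\boldsymbol{x}_i^t)-\boldsymbol{m}_i^t\big),\qquad \boldsymbol{x}_i^{t+1}=\sum_{j=1}^nw_{ij}\big(\boldsymbol{x}_j^t-\eta_t\boldsymbol{m}_j^{t+1}\big).$$ *)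

(* Defs.v *)
From HB Require Import structures.
From mathcomp Require Import all_boot all_order all_algebra.
From mathcomp Require Import all_classical all_reals all_analysis.

Set Implicit Arguments.
Unset Strict Implicit.
Unset Printing Implicit Defensive.

Import Order.TTheory GRing.Theory Num.Theory.
Import numFieldNormedType.Exports.

Local Open Scope classical_set_scope.
Local Open Scope ring_scope.

Section Euclidean.
Context {R : realType}.

                                                                            
                                                                                 
Definition norm2 {m n} (A : 'M[R]_(m, n)) : R :=
  Num.sqrt (\sum_i \sum_j A i j ^+ 2).

Definition opnorm2 {m n} (A : 'M[R]_(m, n)) : R :=
  sup [set norm2 (A *m v) | v in [set v : 'cV[R]_n | norm2 v <= 1]].

Definition psd {d} (A : 'M[R]_d) : Prop :=
  A^T = A /\ forall v : 'rV[R]_d, 0 <= (v *m A *m v^T) 0 0.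

                                          
Definition loewner_le {d} (A B : 'M[R]_d) : Prop := psd (B - A).

Definition grad {d} (f : 'rV[R]_d -> R) (x : 'rV[R]_d) : 'rV[R]_d :=
  \row_j 'D_(delta_mx 0 j) f x.

Definition hess {d} (f : 'rV[R]_d -> R) (x : 'rV[R]_d) : 'M[R]_d :=
  'J (grad f) x.

Definition twice_continuously_differentiable {d} (f : 'rV[R]_d -> R) : Prop :=
  [/\ forall x, differentiable f x,
      forall x, differentiable (grad f) x &
      continuous (hess f)].

Definition average {n d} (f : 'I_n -> 'rV[R]_d -> R) (x : 'rV[R]_d) : R :=
  n%:R^-1 * \sum_i f i x.

Definition is_argmin {d} (f : 'rV[R]_d -> R) (xs : 'rV[R]_d) : Prop :=
  forall x, f xs <= f x.

Definition function_assumption {n d} (mu L : R)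
    (f : 'I_n -> 'rV[R]_d -> R) : Prop :=
  [/\ 0 < mu, mu <= L &
      forall i, twice_continuously_differentiable (f i) /\
        forall x, loewner_le mu%:M (hess (f i) x) /\
                  loewner_le (hess (f i) x) L%:M].

                                
Definition heterogeneity_assumption {n d} (cstar : R)
    (f : 'I_n -> 'rV[R]_d -> R) (xs : 'rV[R]_d) : Prop :=
  forall i, `|grad (f i) xs| <= cstar.

                                                                            
                                        
Definition network_assumption {n} (W : 'M[R]_n) (link : rel 'I_n) : Prop :=
  [/\ forall i j, connect link i j,
      forall i j, 0 <= W i j,
      forall i j, W i j != 0 -> [|| i == j, link i j | link j i],
      W *m const_mx 1 = const_mx 1 :> 'cV[R]_n /\
      const_mx 1 *m W = const_mx 1 :> 'rV[R]_n &
      0 <= opnorm2 (W - n%:R^-1 *: const_mx 1) < 1].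

Definition sclip (phi eps y : R) : R := y * phi / Num.sqrt (y ^+ 2 + eps).

                                                                         
            
Fixpoint sclip_ef_network {n d} (f : 'I_n -> 'rV[R]_d -> R) (W : 'M[R]_n)
    (phi eps beta eta : nat -> R) (x0 : 'rV[R]_d)
    (xi : nat -> 'I_n -> 'rV[R]_d) (t : nat) :
    ('I_n -> 'rV[R]_d) * ('I_n -> 'rV[R]_d) :=
  if t is s.+1 then
    let: (x, m) := sclip_ef_network f W phi eps beta eta x0 xi s in
    let g i := grad (f i) (x i) + xi s i in
    let m' i := beta s *: m i +
      (1 - beta s) *: map_mx (sclip (phi s) (eps s)) (g i - m i) in
    (fun i => \sum_j W i j *: (x j - eta s *: m' j), m')
  else (fun=> x0, fun=> 0).

End Euclidean.

Section Noise.
Context {R : realType} {dT : measure_display} {T : measurableType dT}.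
Variable P : probability T R.

Definition mutually_independent {I : choiceType} (F : I -> set_system T) :
    Prop :=
  forall (s : seq I) (A : I -> set T), uniq s ->
    (forall i, i \in s -> F i (A i)) ->
    P (\bigcap_(i in [set` s]) A i) = (\prod_(i <- s) P (A i))%E.

Definition generated_sigma_algebra {I : Type} (X : I -> T -> R) :
    set_system T :=
  <<s \bigcup_i preimage_set_system setT (X i) measurable >>.

Definition has_density (X : {RV P >-> R}) (p : R -> R) : Prop :=
  forall B : set R, measurable B ->
    distribution P X B = (\int[lebesgue_measure]_(u in B) (p u)%:E)%E.

                                                                          
                                                                            
                                   
Definition noise_assumption {n d} (sigma : R)
    (xi : nat -> 'I_n -> 'I_d -> {RV P >-> R}) : Prop :=
  [/\ 0 < sigma,
      mutually_independent (fun t : nat =>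
        generated_sigma_algebra (fun ik : 'I_n * 'I_d => xi t ik.1 ik.2)) &
      exists p : R -> R,
        [/\ measurable_fun setT p,
            forall u, 0 <= p u,
            forall u, p u = p (- u),
            forall t i k, has_density (xi t i k) p &
            (\int[lebesgue_measure]_u (`|u| * p u)%:E <= sigma%:E)%E]].

End Noise.

(* Main.v *)
Require Import Defs.
From HB Require Import structures.
From mathcomp Require Import all_boot all_order all_algebra.
From mathcomp Require Import all_classical all_reals all_analysis.
From mathcomp Require Import measurable_realfun.
From mathcomp Require Import ring lra.
Import Order.TTheory GRing.Theory Num.Theory.
Import numFieldNormedType.Exports.

(** The proof follows the mean iterate in expectation, and the clipping enters it
    three times.

    First, it makes everything bounded. Whatever the noise, the momentum at step t
    has entries O(t^(-1/2)), so with step sizes of order t^(-1/5) the mean iterate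
    drifts by at most O(t^(3/10)) ([mean_error_growth]), and the nodes agree up to
    O(t^(-1/5)) because the mixing matrix contracts deviations from the average
    ([consensus_near]). Now t^(3/10) is also the order of the square root of the
    smoothing, the scale on which the clipping is nearly linear.

    Second, after averaging over the noise of the current step, which is
    independent of the state ([sclip_decoupling]), the clipping acts on a gradient
    as multiplication by the gain phi / sqrt eps, up to a relative error of order
    gradient^2 / eps + sigma / sqrt eps ([smoothed_clip_linearization]); this uses
    the first absolute moment only. The error depends on the coordinate and on the
    node, so the expected step is a diagonal, not a scalar, multiple of a gradient
    difference. A diagonal distortion of relative size below 1 / sqrt kappa still
    leaves half of the strong monotonicity ([grad_perturbed_monotone]). The
    distortion is at most of order d kappa^2 sigma^2 / tau, which the condition on
    tau turns into 1 / sqrt kappa ([parameter_window]). Heterogeneity costs little: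
    at the minimizer the gradients are bounded and sum to zero, the symmetry of the
    noise makes the averaged clipping vanish at 0, and so only its nonlinearity
    there survives ([drift_lower_bound], [drift_near]).

    Third, it bounds the squared step surely by O(t^(-7/5)), without a second
    moment of the noise. As step size times gain is a multiple of 1 / t, the mean
    squared error u satisfies, for late t,
    u (t+1) <= (1 - c / t) u t + C t^(-7/5) with c of the order of
    d^(-1/2) kappa^(-5/4) ([energy_recursion]), which gives every rate below
    min (c, 2/5) ([rate_recursion]). *)

Local Open Scope classical_set_scope.
Local Open Scope ring_scope.

Set Implicit Arguments.
Unset Strict Implicit.
Unset Printing Implicit Defensive.

(** * The time scale and the limiting recursion *)

Section TimeScale.
Context {R : realType}.

(** All schedules are monomials in this tenth root of t + 1, so that the proof
    computes with integer powers only. *)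
Definition scale (t : nat) : R := t.+1%:R `^ (1 / 10).
Local Notation r := scale.

Lemma scale_gt0 t : 0 < r t. Proof. by rewrite powR_gt0. Qed.

Lemma scale_ge1 t : 1 <= r t.
Proof.
by rewrite -[leLHS](powRr0 (t.+1%:R : R)) ler_powR// ?ler1n//; lra.
Qed.

Lemma powR_scale (k : nat) t : t.+1%:R `^ (k%:R / 10) = r t ^+ k.
Proof.
rewrite -powR_mulrn ?ltW ?scale_gt0// -powRrM; congr (_ `^ _).
by rewrite mulrAC mul1r.
Qed.

Lemma scaleX10 t : r t ^+ 10 = t.+1%:R.
Proof. by rewrite -powR_scale mulfV ?powRr1//. Qed.

Lemma sqrt_scale t : Num.sqrt t.+1%:R = r t ^+ 5.
Proof.
by rewrite -powR12_sqrt// -powR_scale; congr (_ `^ _); field.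
Qed.

Lemma scale_leS t : r t <= r t.+1.
Proof.
rewrite -(@ler_pXn2r _ 10) ?nnegrE ?(ltW (scale_gt0 _))// !scaleX10.
by rewrite ler_nat.
Qed.

Lemma scaleSX10 t : r t.+1 ^+ 10 = r t ^+ 10 + 1.
Proof. by rewrite !scaleX10 natr1. Qed.

Lemma scaleX_ge1 k t : 1 <= r t ^+ k.
Proof. exact/exprn_ege1/scale_ge1. Qed.

Lemma scaleSX (k : nat) t : (k <= 10)%N -> r t.+1 ^+ k <= (1 + (r t ^+ 10)^-1) * r t ^+ k.
Proof.
move=> k10; have r0 := scale_gt0 t.
rewrite -ler_pdivrMr ?exprn_gt0// -expr_div_n.
have q1 : 1 <= r t.+1 / r t by rewrite ler_pdivlMr// mul1r scale_leS.
apply: (le_trans (ler_weXn2l q1 k10)).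
rewrite expr_div_n scaleSX10 mulrDl mul1r mulfV//.
by rewrite expf_eq0 /= gt_eqF.
Qed.

Lemma scaleSX2 (k : nat) t : (k <= 10)%N -> r t.+1 ^+ k <= 2 * r t ^+ k.
Proof.
move=> k10; apply: (le_trans (scaleSX t k10)).
rewrite ler_wpM2r ?exprn_ge0 ?(ltW (scale_gt0 _))//.
have := scaleX_ge1 10 t; rewrite -invf_le1 ?exprn_gt0 ?scale_gt0// => h.
by rewrite -[leRHS]/(1 + 1) lerD2l.
Qed.

(** Discrete counterpart of the derivative (3/10) s^(-7/10) of s^(3/10): it sums
    increments of size s^(-7/10) by telescoping. With a and b consecutive
    values of the scale, 1 = b^10 - a^10 is at most 10 b^9 (b - a) while
    b^3 - a^3 is at least 3 a^2 (b - a), and b^9 <= 2 a^9. *)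
Lemma scale3_increment t : (8 * r t ^+ 7)^-1 <= r t.+1 ^+ 3 - r t ^+ 3.
Proof.
set a := r t; set b := r t.+1.
have a0 : 0 < a := scale_gt0 t; have b0 : 0 < b := scale_gt0 t.+1.
have ab : a <= b := scale_leS t.
have h : 1 = (b - a) * \sum_(i < 10) b ^+ (9 - i) * a ^+ i.
  by rewrite -subrXX /b scaleSX10 addrAC subrr add0r.
have hs : \sum_(i < 10) b ^+ (9 - i) * a ^+ i <= 20 * a ^+ 9.
  apply: (@le_trans _ _ (\sum_(i < 10) b ^+ 9)).
    apply: ler_sum => i _.
    have -> : b ^+ 9 = b ^+ (9 - i) * b ^+ i.
      by rewrite -exprD subnK// -ltnS ltn_ord.
    by rewrite ler_wpM2l ?exprn_ge0 ?(ltW b0)// lerXn2r ?nnegrE ?(ltW a0) ?(ltW b0).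
  rewrite sumr_const card_ord -[leLHS]mulr_natl.
  by have : b ^+ 9 <= 2 * a ^+ 9 := @scaleSX2 9 t isT; lra.
have ba0 : 0 <= b - a by rewrite subr_ge0.
have hba : 1 <= (b - a) * (20 * a ^+ 9) by rewrite {1}h ler_wpM2l.
have h3 : (b - a) * (3 * a ^+ 2) <= b ^+ 3 - a ^+ 3.
  have -> : b ^+ 3 - a ^+ 3 = (b - a) * (b ^+ 2 + a * b + a ^+ 2) by ring.
  apply: ler_wpM2l => //.
  have : a ^+ 2 <= a * b by rewrite expr2 ler_pM2l.
  have : a ^+ 2 <= b ^+ 2 by rewrite lerXn2r ?nnegrE ?(ltW a0) ?(ltW b0).
  lra.
rewrite -(ler_pM2r (_ : 0 < 8 * a ^+ 7)) ?mulr_gt0 ?exprn_gt0//.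
rewrite mulVf; last by rewrite mulf_neq0 // expf_eq0 /= gt_eqF.
have : (b - a) * (3 * a ^+ 2) * (8 * a ^+ 7) <= (b ^+ 3 - a ^+ 3) * (8 * a ^+ 7).
  by rewrite ler_wpM2r// mulr_ge0// exprn_ge0// ltW.
have -> : (b - a) * (3 * a ^+ 2) * (8 * a ^+ 7) = 6 / 5 * ((b - a) * (20 * a ^+ 9)) by field.
lra.
Qed.

Lemma powR_near_ge (a M : R) : 0 < a -> \forall t \near \oo, M <= t.+1%:R `^ a.
Proof.
move=> a0; near=> t.
have [M0|M0] := leP M 0; first by rewrite (le_trans M0)// powR_ge0.
have -> : M = (M `^ a^-1) `^ a by rewrite -powRrM mulVf ?gt_eqF// powRr1// ltW.
apply: ge0_ler_powR; [exact: ltW|by rewrite nnegrE powR_ge0|by rewrite nnegrE|].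
apply: (@le_trans _ _ t%:R); last by rewrite ler_nat.
by near: t; exact: nbhs_infty_ger.
Unshelve. all: by end_near. Qed.

Lemma scale_near_ge (M : R) : \forall t \near \oo, M <= r t.
Proof. by apply: powR_near_ge; lra. Qed.

Lemma scaleX_near_ge (k : nat) (M : R) : (0 < k)%N -> \forall t \near \oo, M <= r t ^+ k.
Proof.
move=> k0; near=> t; apply: (@le_trans _ _ (r t)); last by rewrite ler_eXnr// scale_ge1.
by near: t; exact: scale_near_ge.
Unshelve. all: by end_near. Qed.

Lemma powRN_cvg0 (a : R) : 0 < a -> t.+1%:R `^ (- a) @[t --> \oo] --> (0 : R).
Proof.
move=> a0; apply/cvgrPdist_le => e e0; near=> t.
rewrite sub0r normrN ger0_norm ?powR_ge0// powRN.
rewrite invf_ple ?posrE ?powR_gt0//.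
by near: t; exact: powR_near_ge.
Unshelve. all: by end_near. Qed.

(** Young's inequality for the conjugate exponents 1/a and 1/(1 - a), applied to
    the numbers (1 + x)^a and 1. *)
Lemma powR_bernoulli (a x : R) : 0 < a < 1 -> 0 <= x -> (1 + x) `^ a <= 1 + a * x.
Proof.
move=> /andP[a0 a1] x0.
have b0 : 0 < 1 - a by rewrite subr_gt0.
have := @conjugate_powR R ((1 + x) `^ a) 1 a^-1 (1 - a)^-1.
rewrite powR_ge0 ler01 !invr_gt0 a0 b0 !invrK subrKC -powRrM mulfV ?gt_eqF//.
rewrite powR1 powRr1 ?addr_ge0// mulr1 mul1r => /(_ isT isT isT isT erefl).
lra.
Qed.

(** Weigh u by (t+1)^d' with delta < d' < min(c, 2/5). By Bernoulli's inequality
    the weight grows by a factor at most 1 + d'/(t+1) per step, which the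
    contraction c/(t+1) absorbs, and it turns the forcing term into
    O(1/(t+1)); the weighted sequence is then bounded, and (t+1)^delta u is
    O((t+1)^(delta - d')). *)
Lemma rate_recursion (u : nat -> R) (c C delta : R) :
  (forall t, 0 <= u t) -> 0 <= C -> 0 < delta < Num.min c (2 / 5) ->
  (\forall t \near \oo, u t.+1 <= (1 - c / r t ^+ 10) * u t + C / r t ^+ 14) ->
  t.+1%:R `^ delta * u t @[t --> \oo] --> 0.
Proof.
move=> u0 C0 /andP[d0]; rewrite lt_min => /andP[dc d25] hu.
(* the truncation at 1 keeps the factors 1 - c'/(t+1) nonnegative for all t *)
pose c' := Num.min (Num.min c (2 / 5)) 1.
have dc' : delta < c' by rewrite !lt_min dc d25 /=; lra.
pose d' := (delta + c') / 2.
have c'c : c' <= c by rewrite /c' !ge_min lexx.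
have c'25 : c' <= 2 / 5 by rewrite /c' !ge_min lexx orbT.
pose v t := t.+1%:R `^ d' * u t.
pose g := c' - d'.
have g0 : 0 < g by rewrite /g /d'; lra.
have d'0 : 0 < d' by rewrite /d'; lra.
have d'1 : d' < 2 / 5 by rewrite /d'; lra.
have v0 t : 0 <= v t by rewrite mulr_ge0// powR_ge0.
have hv : \forall t \near \oo, v t.+1 <= (1 - g / r t ^+ 10) * v t + 2 * C / r t ^+ 10.
  near=> t.
  have h : u t.+1 <= (1 - c / r t ^+ 10) * u t + C / r t ^+ 14 by near: t.
  set s := r t ^+ 10; have s1 : 1 <= s := scaleX_ge1 10 t.
  have s0 : 0 < s by lra.
  have is1 : s^-1 <= 1 by rewrite invf_le1.
  have is0 : 0 < s^-1 by rewrite invr_gt0.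
  have h' : u t.+1 <= (1 - c' / s) * u t + C / r t ^+ 14.
    apply: (le_trans h); rewrite lerD2r ler_wpM2r// lerD2l lerN2 ler_wpM2r//.
    exact: ltW.
  have p0 : 0 <= t.+1%:R `^ d' :> R := powR_ge0 _ _.
  have q : t.+2%:R `^ d' <= (1 + d' / s) * t.+1%:R `^ d' :> R.
    have -> : t.+2%:R = (1 + s^-1) * t.+1%:R :> R.
      by rewrite -natr1 -scaleX10 -/s; field; rewrite gt_eqF.
    rewrite powRM// ?addr_ge0 ?(ltW is0)// ler_wpM2r// powR_bernoulli ?(ltW is0)//.
    rewrite d'0 /=; lra.
  have q2 : t.+2%:R `^ d' <= 2 * r t ^+ 4 :> R.
    apply: (le_trans q); apply: ler_pM => //.
    - by rewrite addr_ge0// mulr_ge0// ltW.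
    - have : d' / s <= 1 * 1 by apply: ler_pM => //; [exact: ltW|exact: ltW|lra].
      by lra.
    - rewrite -powR_scale ler_powR ?ler1n//; lra.
  rewrite /v.
  apply: (@le_trans _ _ (t.+2%:R `^ d' * ((1 - c' / s) * u t + C / r t ^+ 14))).
    by rewrite ler_wpM2l// powR_ge0.
  have cs0 : 0 <= 1 - c' / s.
    have : c' / s <= 1 * 1.
      apply: ler_pM => //; [by rewrite /g /d' in g0 d'0 *; lra|exact: ltW|lra].
    lra.
  rewrite mulrDr; apply: lerD; last first.
    rewrite (_ : 2 * C / s = (2 * r t ^+ 4) * (C / r t ^+ 14)).
      by rewrite ler_wpM2r// divr_ge0// exprn_ge0// ltW// scale_gt0.
    by rewrite /s; field; rewrite gt_eqF// scale_gt0.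
  rewrite mulrA [leRHS]mulrA; apply: ler_wpM2r => //.
  apply: (@le_trans _ _ ((1 + d' / s) * t.+1%:R `^ d' * (1 - c' / s))).
    by rewrite ler_wpM2r.
  rewrite -mulrA mulrCA [leRHS]mulrC ler_wpM2l//.
  have : 0 <= d' / s * (c' / s) by rewrite !mulr_ge0 ?(ltW is0) ?(ltW d'0)// /g /d' in g0 d'0 *; lra.
  rewrite /g; lra.
have [M Mv] : exists M, \forall t \near \oo, v t <= M.
  (* 2C/g is the fixed point of the recursion, hence an invariant upper bound *)
  case: hv => N _ hN; pose M := Num.max (v N) (2 * C / g).
  exists M; exists N => // t /= Nt.
  rewrite -(subnK Nt); elim: (t - N)%N => [|k IH]; first by rewrite add0n /M le_max lexx.
  rewrite addSn; apply: (le_trans (hN _ (leq_addl _ _))).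
  set s := r _ ^+ 10; have s1 : 1 <= s := scaleX_ge1 10 _.
  have s0 : 0 < s by lra.
  have gs : 0 <= 1 - g / s.
    have : g / s <= 1 * 1.
      apply: ler_pM => //; [exact: ltW|by rewrite invr_ge0 ltW|rewrite /g; lra|].
      by rewrite invf_le1.
    lra.
  have h1 : (1 - g / s) * v (k + N)%N <= (1 - g / s) * M by rewrite ler_wpM2l.
  have h2 : 2 * C / s <= g / s * M.
    rewrite [leRHS]mulrAC ler_wpM2r ?invr_ge0 ?(ltW s0)//.
    by rewrite [leRHS]mulrC -ler_pdivrMr// /M le_max lexx orbT.
  lra.
apply: (@squeeze_cvgr _ _ _ _ (fun=> 0) (fun t => M * t.+1%:R `^ (- (d' - delta)))).
- near=> t; apply/andP; split; first by rewrite mulr_ge0// powR_ge0.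
  have -> : t.+1%:R `^ delta * u t = v t * t.+1%:R `^ (- (d' - delta)).
    rewrite /v mulrAC -powRD; last by rewrite pnatr_eq0 /= implybT.
    by congr (_ `^ _ * _); ring.
  by rewrite ler_wpM2r ?powR_ge0//; near: t.
- exact: cvg_cst.
- rewrite -[X in _ --> X](mulr0 M); apply: cvgMl_tmp; apply: powRN_cvg0.
  by rewrite /d'; lra.
Unshelve. all: by end_near. Qed.
End TimeScale.

(** * Smooth clipping of a scalar *)

Section Clipping.
Context {R : realType}.
Implicit Types (p q a b y xi phi eps M m : R).

(** Clipping at level 1 with smoothing 1; [sclipE] rescales it to the general
    case. *)
Definition unit_clip y : R := y / Num.sqrt (y ^+ 2 + 1).

(** The chord slope of [unit_clip] has the closed form (1 + AB - pq) / (AB (A + B)),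
    where A = sqrt(p^2 + 1) and B = sqrt(q^2 + 1). Since AB >= 1 + |pq| it lies
    between 0 and 1, and it is at least 2 / (AB (A + B)), which is close to 1
    for small arguments. *)
Lemma unit_clip_slope p q : exists theta : R,
  [/\ unit_clip p - unit_clip q = theta * (p - q), 0 <= theta <= 1 &
      forall m, p ^+ 2 <= m -> q ^+ 2 <= m -> 1 - theta <= 3 / 2 * m].
Proof.
rewrite /unit_clip; set A := Num.sqrt (p ^+ 2 + 1); set B := Num.sqrt (q ^+ 2 + 1).
have hA : A ^+ 2 = p ^+ 2 + 1 by rewrite sqr_sqrtr// addr_ge0// sqr_ge0.
have hB : B ^+ 2 = q ^+ 2 + 1 by rewrite sqr_sqrtr// addr_ge0// sqr_ge0.
have A1 : 1 <= A by rewrite -sqrtr1 ler_wsqrtr// lerDr sqr_ge0.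
have B1 : 1 <= B by rewrite -sqrtr1 ler_wsqrtr// lerDr sqr_ge0.
have A0 : 0 < A by lra. have B0 : 0 < B by lra.
have AB0 : 0 < A * B by rewrite mulr_gt0.
have hpq : 1 + `|p * q| <= A * B.
  rewrite -(@ler_pXn2r _ 2)// ?nnegrE ?addr_ge0//; last exact: ltW.
  rewrite exprMn hA hB sqrrD expr1n real_normK ?num_real// normrM exprMn.
  have := sqr_ge0 (`|p| - `|q|); rewrite sqrrB !real_normK ?num_real//.
  lra.
have /andP[pq1 pq2] : - `|p * q| <= p * q <= `|p * q| by rewrite -ler_norml.
pose D := A * B * (A + B); have D0 : 0 < D by rewrite mulr_gt0// addr_gt0.
exists ((1 + A * B - p * q) / D); split.
- have e : (p * B - q * A) * (A + B) = (1 + A * B - p * q) * (p - q).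
    have -> : (p * B - q * A) * (A + B) = (p - q) * (A * B) + p * B ^+ 2 - q * A ^+ 2 by ring.
    by rewrite hA hB; ring.
  rewrite mulrAC -e /D; field.
  by rewrite !gt_eqF// addr_gt0.
- apply/andP; split; first by apply: divr_ge0; lra.
  rewrite ler_pdivrMr// mul1r /D.
  have : 0 <= A * B * (A + B - 2) by apply: mulr_ge0; lra.
  lra.
- move=> m pm qm; rewrite lerBlDr -lerBlDl ler_pdivlMr//.
  have m0 : 0 <= m by apply: le_trans pm; exact: sqr_ge0.
  (* sqrt(1 + m) <= 1 + m/2, and (1 + m/2)^(-3) >= 1 - 3m/2 *)
  pose h := 1 + m / 2.
  have Ah : A <= h.
    rewrite -(@ler_pXn2r _ 2)// ?nnegrE; [|exact: ltW|rewrite /h; lra].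
    by rewrite hA /h; have := sqr_ge0 m; lra.
  have Bh : B <= h.
    rewrite -(@ler_pXn2r _ 2)// ?nnegrE; [|exact: ltW|rewrite /h; lra].
    by rewrite hB /h; have := sqr_ge0 m; lra.
  have h0 : 0 <= h by lra.
  have [l|g] := leP (1 - 3 / 2 * m) 0.
    have : (1 - 3 / 2 * m) * D <= 0 by apply: mulr_le0_ge0 => //; exact: ltW.
    lra.
  have Dh : D <= 2 * h ^+ 3.
    have -> : 2 * h ^+ 3 = (h * h) * (h + h) by ring.
    by rewrite /D; apply: ler_pM; [exact: ltW|lra| |lra]; apply: ler_pM; lra.
  have h3 : (1 - 3 / 2 * m) * h ^+ 3 <= 1.
    have -> : (1 - 3 / 2 * m) * h ^+ 3 =
      1 - (6 * (m / 2) ^+ 2 + 8 * (m / 2) ^+ 3 + 3 * (m / 2) ^+ 4) by rewrite /h; field.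
    have k0 : 0 <= m / 2 by lra.
    have := exprn_ge0 2 k0; have := exprn_ge0 3 k0; have := exprn_ge0 4 k0; lra.
  have : (1 - 3 / 2 * m) * D <= (1 - 3 / 2 * m) * (2 * h ^+ 3) by rewrite ler_wpM2l// ltW.
  lra.
Qed.

Lemma sclipE phi eps y : 0 < eps ->
  sclip phi eps y = phi * unit_clip (y / Num.sqrt eps).
Proof.
move=> e0; rewrite /sclip /unit_clip.
have s0 : 0 < Num.sqrt eps by rewrite sqrtr_gt0.
have -> : y ^+ 2 + eps = eps * ((y / Num.sqrt eps) ^+ 2 + 1).
  by rewrite exprMn exprVn sqr_sqrtr ?(ltW e0)//; field; rewrite gt_eqF.
rewrite (sqrtrM _ (ltW e0)); field.
rewrite !gt_eqF// sqrtr_gt0.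
by have := sqr_ge0 (y / Num.sqrt eps); lra.
Qed.

Lemma sclip_bound phi eps y : 0 <= phi -> 0 < eps -> `|sclip phi eps y| <= phi.
Proof.
move=> p0 e0; rewrite sclipE// normrM ger0_norm// -[leRHS]mulr1 ler_wpM2l//.
set z := _ / _; rewrite /unit_clip normrM normfV (ger0_norm (sqrtr_ge0 _)).
have z1 : 0 < z ^+ 2 + 1 by have := sqr_ge0 z; lra.
rewrite ler_pdivrMr ?sqrtr_gt0// mul1r -(sqrtr_sqr z) ler_wsqrtr//; lra.
Qed.

Lemma sclipN phi eps y : sclip phi eps (- y) = - sclip phi eps y.
Proof. by rewrite /sclip sqrrN !mulNr. Qed.

Lemma sclip_lipschitz phi eps a b : 0 <= phi -> 0 < eps ->
  `|sclip phi eps a - sclip phi eps b| <= phi / Num.sqrt eps * `|a - b|.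
Proof.
move=> p0 e0; have s0 : 0 < Num.sqrt eps by rewrite sqrtr_gt0.
rewrite !sclipE// -mulrBr.
have [th [-> /andP[t0 t1] _]] := unit_clip_slope (a / Num.sqrt eps) (b / Num.sqrt eps).
rewrite -mulrBl !normrM (ger0_norm p0) (ger0_norm t0) normfV (ger0_norm (ltW s0)).
by rewrite -mulrA ler_wpM2l// [leRHS]mulrC ler_piMl// mulr_ge0// invr_ge0 (ltW s0).
Qed.

(** The relative error of linearization is at most 1 and at most
    (3/2) (M + |xi|)^2 / eps. The smaller of the two bounds grows only linearly
    in |xi|, which is why a first moment of the noise suffices. *)
Lemma sclip_linearization phi eps M xi a b : 0 <= phi -> 0 < eps ->
  `|a| <= M -> `|b| <= M ->
  `|sclip phi eps (a + xi) - sclip phi eps (b + xi) - phi / Num.sqrt eps * (a - b)|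
    <= phi / Num.sqrt eps * `|a - b| *
       (3 * M ^+ 2 / eps + 2 * `|xi| / Num.sqrt eps).
Proof.
move=> p0 e0 aM bM; set s := Num.sqrt eps.
have s0 : 0 < s by rewrite sqrtr_gt0.
have seps : eps = s ^+ 2 by rewrite sqr_sqrtr// ltW.
rewrite !sclipE// -/s.
have [th [ht /andP[t0 t1] hm]] := unit_clip_slope ((a + xi) / s) ((b + xi) / s).
rewrite -mulrBr ht.
have -> : phi * (th * ((a + xi) / s - (b + xi) / s)) - phi / s * (a - b) =
   - (phi / s * (a - b) * (1 - th)) by field; rewrite gt_eqF.
rewrite normrN normrM (ger0_norm (_ : 0 <= 1 - th)) ?subr_ge0//.
rewrite normrM (ger0_norm (_ : 0 <= phi / s)); last by rewrite divr_ge0 ?(ltW s0).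
apply: ler_wpM2l; first by rewrite mulr_ge0// divr_ge0 ?(ltW s0).
pose v := `|xi| / s; have v0 : 0 <= v by rewrite divr_ge0 ?(ltW s0).
pose N := M / s; have N0 : 0 <= N by rewrite divr_ge0 ?(ltW s0)// (le_trans _ aM).
have -> : 3 * M ^+ 2 / eps + 2 * `|xi| / s = 3 * N ^+ 2 + 2 * v.
  by rewrite seps /N /v; field; rewrite gt_eqF.
have [v1|v1] := leP (1 / 2) v.
  have := sqr_ge0 N; lra.
have hb (c : R) : `|c| <= M -> ((c + xi) / s) ^+ 2 <= (N + v) ^+ 2.
  move=> cM; rewrite -(real_normK (num_real ((c + xi) / s))).
  rewrite lerXn2r ?nnegrE ?addr_ge0// /N /v -mulrDl normrM normfV (ger0_norm (ltW s0)).
  by rewrite ler_wpM2r ?invr_ge0 ?(ltW s0)// (le_trans (ler_normD _ _))// lerD2r.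
have := hm _ (hb a aM) (hb b bM).
have : (N + v) ^+ 2 <= 2 * N ^+ 2 + 2 * v ^+ 2.
  by have := sqr_ge0 (N - v); rewrite !expr2; lra.
have : v ^+ 2 <= 1 / 2 * v by rewrite expr2 ler_wpM2r// ltW.
lra.
Qed.

Lemma continuous_sclip phi eps : 0 < eps -> continuous (sclip phi eps).
Proof.
move=> e0 x; rewrite /sclip.
have den0 : 0 < Num.sqrt (x ^+ 2 + eps).
  by rewrite sqrtr_gt0; have := sqr_ge0 x; lra.
have h : (y ^+ 2 + eps) @[y --> x] --> x ^+ 2 + eps.
  by apply: cvgD; [exact: exprn_continuous|exact: cvg_cst].
apply: cvgM; first by apply: cvgMr_tmp.
apply: cvgV; first by rewrite gt_eqF.
by apply: (continuous_cvg _ _ h); exact: sqrt_continuous.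
Qed.
End Clipping.

(** * Inner product and mean value formula for gradients *)

Section InnerProduct.
Context {R : realType} {d : nat}.
Implicit Types u v w : 'rV[R]_d.

Definition dot u v : R := \sum_k u 0 k * v 0 k.

Lemma dotC u v : dot u v = dot v u.
Proof. by apply: eq_bigr => k _; rewrite mulrC. Qed.

Lemma dotDl u v w : dot (u + v) w = dot u w + dot v w.
Proof. by rewrite /dot -big_split; apply: eq_bigr => k _ /=; rewrite mxE mulrDl. Qed.

Lemma dotZl a u w : dot (a *: u) w = a * dot u w.
Proof. by rewrite /dot mulr_sumr; apply: eq_bigr => k _ /=; rewrite mxE mulrA. Qed.

Lemma dotDr u v w : dot w (u + v) = dot w u + dot w v.
Proof. by rewrite !(dotC w) dotDl. Qed.

Lemma dotZr a u w : dot w (a *: u) = a * dot w u.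
Proof. by rewrite !(dotC w) dotZl. Qed.

Lemma dotNl u w : dot (- u) w = - dot u w.
Proof. by rewrite -scaleN1r dotZl mulN1r. Qed.

Lemma dotNr u w : dot w (- u) = - dot w u.
Proof. by rewrite !(dotC w) dotNl. Qed.

Definition dotE := (dotDl, dotDr, dotNl, dotNr, dotZl, dotZr).

Lemma dot_sumr (I : finType) (F : I -> 'rV[R]_d) w :
  dot w (\sum_i F i) = \sum_i dot w (F i).
Proof.
rewrite /dot exchange_big; apply: eq_bigr => k _.
by rewrite summxE mulr_sumr.
Qed.

Lemma dotvv_ge0 v : 0 <= dot v v.
Proof. by apply: sumr_ge0 => k _; rewrite -expr2 sqr_ge0. Qed.

Lemma norm2_sqr v : norm2 v ^+ 2 = dot v v.
Proof.
rewrite /norm2 sqr_sqrtr; last by do 2 (apply: sumr_ge0 => ? _); exact: sqr_ge0.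
by rewrite big_ord1; apply: eq_bigr => k _; rewrite expr2.
Qed.

Lemma sqr_coord_le_dot v k : v 0 k ^+ 2 <= dot v v.
Proof.
rewrite /dot (bigD1 k)//= -expr2 lerDl.
by apply: sumr_ge0 => i _; rewrite -expr2 sqr_ge0.
Qed.

Lemma dot_young (a : R) u v : 0 < a -> 2 * dot u v <= a * dot u u + a^-1 * dot v v.
Proof.
move=> a0; have h := dotvv_ge0 (a *: u - v); move: h; rewrite !dotE (dotC v u) => h.
have : 0 <= a^-1 * (a * (a * dot u u) + - (a * dot u v) + - (a * dot u v - dot v v)).
  by apply: mulr_ge0; [rewrite invr_ge0 ltW|lra].
have e : a^-1 * (a * (a * dot u u) + - (a * dot u v) + - (a * dot u v - dot v v)) =
  a * dot u u - 2 * dot u v + a^-1 * dot v v by field; rewrite gt_eqF.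
by rewrite e; lra.
Qed.

Lemma dotvv_eq0 v : (dot v v == 0) = (v == 0).
Proof.
apply/eqP/eqP => [h|->]; last by rewrite /dot big1// => k _; rewrite mxE mul0r.
apply/rowP => k; rewrite mxE; apply/eqP; rewrite -sqrf_eq0 eq_le sqr_ge0 andbT.
by rewrite -h sqr_coord_le_dot.
Qed.

Lemma cauchy_schwarz u v : dot u v ^+ 2 <= dot u u * dot v v.
Proof.
have [/eqP|v0] := eqVneq (dot v v) 0.
  rewrite dotvv_eq0 => /eqP->; rewrite [dot u 0](_ : _ = 0) ?expr0n ?mulr_ge0 ?dotvv_ge0//.
  by rewrite /dot big1// => k _; rewrite mxE mulr0.
have vp : 0 < dot v v by rewrite lt_def v0 dotvv_ge0.
have := dotvv_ge0 (dot v v *: u - dot u v *: v); rewrite !dotE (dotC v u) => h.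
rewrite -(ler_pM2l vp); lra.
Qed.

Lemma continuous_dotr v : continuous (dot v).
Proof.
apply: continuous_big => [|k _]; first exact: add_continuous.
by move=> x; apply: continuousM; [exact: cst_continuous|exact: coord_continuous].
Qed.
End InnerProduct.

Section MeanValue.
Context {R : realType} {d : nat}.
Implicit Types (f : 'rV[R]_d -> R) (x y z v : 'rV[R]_d).

(** Tested against a fixed direction, the increment of the gradient is a scalar
    function along the segment, so that a single intermediate Hessian gives it
    exactly. *)
Lemma grad_mvt f v y z : (forall x, differentiable (grad f) x) ->
  exists x, dot v (grad f (y + z)) - dot v (grad f y) = dot v (z *m hess f x).
Proof.
move=> df; pose phi (s : R) := dot v (grad f (s *: z + y)).
have dphi (s : R) : is_derive s 1 phi (dot v (z *m hess f (s *: z + y))).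
  have : (h^-1 *: (phi (h *: 1 + s) - phi s)) @[h --> 0^'] -->
         (dot v (z *m hess f (s *: z + y)) : R).
    have dg := df (s *: z + y).
    have := @diff_derivable _ _ _ _ _ z dg.
    move=> /cvg_ex[l hl].
    have <- : 'D_z (grad f) (s *: z + y) = z *m hess f (s *: z + y).
      exact: deriveEjacobian.
    have -> : 'D_z (grad f) (s *: z + y) = l by apply: cvg_lim hl.
    rewrite (_ : (fun h => _) = dot v \o
        (fun h => h^-1 *: (grad f (h *: z + (s *: z + y)) - grad f (s *: z + y)))).
      by apply: continuous_cvg hl; exact: continuous_dotr.
    apply/funext => h; rewrite /= dotZr dotDr dotNr /phi; congr (_ * (dot v (grad f _) - _)).
    by rewrite addrA -scalerDl /GRing.scale /= mulr1.
  by move=> hc; apply: DeriveDef; [apply/cvg_ex; eexists; exact: hc|exact: cvg_lim hc].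
have [|c _] := @MVT R phi _ 0 1 ltr01 (fun s _ => dphi s).
  apply: continuous_subspaceT => s; apply: differentiable_continuous.
  by apply/derivable1_diffP; have [] := dphi s.
rewrite /phi scale1r scale0r add0r subr0 mulr1 addrC => h.
by exists (c *: z + y); rewrite -h addrC (addrC z).
Qed.
End MeanValue.

(** * Gradients of functions with bounded Hessian *)

Section Hessian.
Context {R : realType} {d : nat}.
Implicit Types (f : 'rV[R]_d -> R) (x y z v e : 'rV[R]_d) (H : 'M[R]_d).

Lemma quadratic_formE H v : (v *m H *m v^T) 0 0 = dot v (v *m H).
Proof. by rewrite mxE dotC; apply: eq_bigr => k _; rewrite [v^T k 0]mxE. Qed.

Lemma dot_mulmx_sym H u v : H^T = H -> dot u (v *m H) = dot v (u *m H).
Proof.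
move=> HT; rewrite /dot.
under eq_bigr => k _ do rewrite mxE mulr_sumr.
under [RHS]eq_bigr => k _ do rewrite mxE mulr_sumr.
rewrite exchange_big; apply: eq_bigr => k _; apply: eq_bigr => j _.
by rewrite -[in LHS]HT mxE mulrCA mulrA mulrC mulrA.
Qed.

Lemma loewner_sandwich (mu L : R) H :
  loewner_le mu%:M H -> loewner_le H L%:M ->
  [/\ H^T = H, forall v, mu * dot v v <= dot v (v *m H) &
      forall v, dot v (v *m H) <= L * dot v v].
Proof.
move=> [s1 p1] [_ p2]; split.
- by apply: (@addIr _ (- mu%:M)); rewrite /= -s1 linearB /= tr_scalar_mx.
- move=> v; have := p1 v; rewrite quadratic_formE mulmxBr mul_mx_scalar !dotE.
  by rewrite subr_ge0.
- move=> v; have := p2 v; rewrite quadratic_formE mulmxBr mul_mx_scalar !dotE.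
  by rewrite subr_ge0.
Qed.

Variables (mu L : R) (f : 'rV[R]_d -> R).
Hypotheses (mu0 : 0 < mu) (muL : mu <= L).
Hypothesis df : forall x, differentiable (grad f) x.
Hypothesis Hf : forall x, loewner_le mu%:M (hess f x) /\ loewner_le (hess f x) L%:M.

(** For a symmetric positive semidefinite H, positivity of the form at z - e
    gives 2 <e, Hz> <= <z, Hz> + <e, He>: replacing z by z - e costs half of
    <z, Hz> and L |e|^2 / 2. Thus e may have size |z| / sqrt(kappa), whereas
    bounding <e, Hz> by L |e| |z| would only allow |z| / kappa. *)
Lemma grad_perturbed_monotone (rho : R) y z e :
  (forall k, `|e 0 k| <= rho * `|z 0 k|) ->
  (mu - L * rho ^+ 2) / 2 * dot z z <=
    dot (z - e) (grad f (y + z) - grad f y).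
Proof.
move=> he; have [x] := grad_mvt (z - e) y z df; rewrite dotDr dotNr => ->.
have [h1 h2] := Hf x; have [hs hmu hL] := loewner_sandwich h1 h2.
have hee : dot e e <= rho ^+ 2 * dot z z.
  rewrite /dot mulr_sumr; apply: ler_sum => k _.
  rewrite -!expr2 -(real_normK (num_real (e 0 k))) -(real_normK (num_real (z 0 k))).
  by rewrite -exprMn lerXn2r ?nnegrE// (le_trans _ (he k)).
have hp := hmu (z - e).
have hp0 : 0 <= dot (z - e) ((z - e) *m hess f x).
  by apply: le_trans hp; rewrite mulr_ge0 ?dotvv_ge0// ltW.
move: hp0; rewrite mulmxBl !dotE (dot_mulmx_sym z e hs) => hp0.
have hz := hmu z; have := hL e.
have L0 : 0 <= L by exact: le_trans (ltW mu0) muL.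
have : L * dot e e <= L * (rho ^+ 2 * dot z z) by apply: ler_wpM2l.
lra.
Qed.

(** Cauchy-Schwarz inequality for the form of the intermediate Hessian. *)
Lemma grad_lipschitz v y z :
  dot v (grad f (y + z) - grad f y) ^+ 2 <= L ^+ 2 * dot v v * dot z z.
Proof.
have [x] := grad_mvt v y z df; rewrite dotDr dotNr => ->.
have [h1 h2] := Hf x; have [hs hmu hL] := loewner_sandwich h1 h2.
have L0 : 0 <= L by exact: le_trans (ltW mu0) muL.
set H := hess f x in hs hmu hL *.
have [/eqP|v0] := eqVneq (dot v v) 0.
  rewrite dotvv_eq0 => /eqP->; rewrite [dot 0 _](_ : _ = 0); last first.
    by rewrite /dot big1// => k _; rewrite mxE mul0r.
  by rewrite expr0n /= !mulr_ge0 ?dotvv_ge0 ?sqr_ge0.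
have vp : 0 < dot v v by rewrite lt_def v0 dotvv_ge0.
have qp : 0 < dot v (v *m H) by apply: lt_le_trans (hmu v); rewrite mulr_gt0.
have zp : 0 <= dot z (z *m H) by apply: le_trans (hmu z); rewrite mulr_ge0 ?dotvv_ge0 ?ltW.
have cs : dot v (z *m H) ^+ 2 <= dot v (v *m H) * dot z (z *m H).
  have := hmu (dot v (v *m H) *: z - dot v (z *m H) *: v).
  set w := _ - _ => hw.
  have {hw} : 0 <= dot w (w *m H) by apply: le_trans hw; rewrite mulr_ge0 ?dotvv_ge0 ?ltW.
  rewrite /w mulmxBl -!scalemxAl !dotE (dot_mulmx_sym z v hs) => h.
  rewrite -(ler_pM2l qp); lra.
apply: (le_trans cs).
have -> : L ^+ 2 * dot v v * dot z z = (L * dot v v) * (L * dot z z) by ring.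
by apply: ler_pM => //; exact: ltW.
Qed.
End Hessian.

Section Stationarity.
Context {R : realType} {d : nat}.

Lemma is_derive_line (f : 'rV[R]_d -> R) (y z : 'rV[R]_d) (s : R) :
  differentiable f (s *: z + y) ->
  is_derive s 1 (fun s => f (s *: z + y)) ('D_z f (s *: z + y)).
Proof.
move=> dg; have /cvg_ex[l hl] := @diff_derivable _ _ _ _ _ z dg.
have -> : 'D_z f (s *: z + y) = l by apply: cvg_lim hl.
have hc : (h^-1 *: (f ((h *: 1 + s) *: z + y) - f (s *: z + y))) @[h --> 0^'] --> l.
  rewrite (_ : (fun h => _) =
      (fun h => h^-1 *: (f (h *: z + (s *: z + y)) - f (s *: z + y))))//.
  apply/funext => h; congr (_ *: (f _ - _)).
  by rewrite addrA -scalerDl /GRing.scale /= mulr1.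
by apply: DeriveDef; [apply/cvg_ex; exists l; exact: hc|exact: cvg_lim hc].
Qed.

Lemma sum_grad_argmin {n : nat} (f : 'I_n -> 'rV[R]_d -> R) (xs : 'rV[R]_d) :
  (0 < n)%N -> (forall i x, differentiable (f i) x) ->
  is_argmin (average f) xs -> \sum_i grad (f i) xs = 0.
Proof.
move=> n0 df hmin; apply/rowP => j; rewrite summxE mxE.
under eq_bigr => i _ do rewrite mxE.
pose z : 'rV[R]_d := delta_mx 0 j.
pose h (s : R) := \sum_i f i (s *: z + xs).
have dh (s : R) : is_derive s 1 h (\sum_i 'D_z (f i) (s *: z + xs)).
  rewrite (_ : h = \sum_i (fun s => f i (s *: z + xs))).
    by apply: is_derive_sum => i; exact: is_derive_line.
  by apply/funext => t; rewrite fct_sumE.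
have [_ h0] : is_derive (0 : R) 1 h 0.
  apply: (@derive1_at_min R h (-1) 1 0) => [|t _||t _].
  - by rewrite (le_trans (lerN10 R)) ?ler01.
  - by have [] := dh t.
  - by rewrite in_itv /= ltrN10 ltr01.
  - have := hmin (t *: z + xs); rewrite /average ler_pM2l ?invr_gt0 ?ltr0n//.
    by rewrite /h scale0r add0r.
by have [_] := dh 0; rewrite h0 scale0r add0r => <-.
Qed.
End Stationarity.

(** * Euclidean norm, operator norm and mixing matrices *)

Section Norm2.
Context {R : realType}.

Lemma norm2_ge0 {m n} (A : 'M[R]_(m, n)) : 0 <= norm2 A.
Proof. exact: sqrtr_ge0. Qed.

Lemma sqr_norm2 {m n} (A : 'M[R]_(m, n)) : norm2 A ^+ 2 = \sum_i \sum_j A i j ^+ 2.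
Proof. by rewrite sqr_sqrtr//; do 2 (apply: sumr_ge0 => ? _); exact: sqr_ge0. Qed.

Lemma norm2_tr {m n} (A : 'M[R]_(m, n)) : norm2 A^T = norm2 A.
Proof.
rewrite /norm2 exchange_big; congr Num.sqrt.
by apply: eq_bigr => i _; apply: eq_bigr => j _; rewrite mxE.
Qed.

Lemma norm2Z {m n} (c : R) (A : 'M[R]_(m, n)) : norm2 (c *: A) = `|c| * norm2 A.
Proof.
rewrite /norm2 -sqrtr_sqr -sqrtrM ?sqr_ge0// mulr_sumr; congr Num.sqrt.
apply: eq_bigr => i _; rewrite mulr_sumr; apply: eq_bigr => j _.
by rewrite mxE exprMn.
Qed.

Lemma norm2N {m n} (A : 'M[R]_(m, n)) : norm2 (- A) = norm2 A.
Proof. by rewrite -scaleN1r norm2Z normrN1 mul1r. Qed.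

Lemma norm2_eq0 {m n} (A : 'M[R]_(m, n)) : norm2 A = 0 -> A = 0.
Proof.
move=> h; have := sqr_norm2 A; rewrite h expr0n /= => /esym/eqP.
rewrite psumr_eq0 => [/allP hi|i _]; last by apply: sumr_ge0 => j _; exact: sqr_ge0.
apply/matrixP => i j; rewrite mxE; apply/eqP; rewrite -sqrf_eq0.
have := hi i (mem_index_enum _); rewrite /= psumr_eq0 => [/allP hj|k _]; last exact: sqr_ge0.
exact: (hj j (mem_index_enum _)).
Qed.

Lemma dot_le_norm2 {d} (u v : 'rV[R]_d) : dot u v <= norm2 u * norm2 v.
Proof.
rewrite (le_trans (ler_norm _))// -(@ler_pXn2r _ 2)// ?nnegrE ?mulr_ge0 ?norm2_ge0//.
by rewrite real_normK ?num_real// exprMn !norm2_sqr cauchy_schwarz.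
Qed.

Lemma norm2D_rV {d} (u v : 'rV[R]_d) : norm2 (u + v) <= norm2 u + norm2 v.
Proof.
rewrite -(@ler_pXn2r _ 2)// ?nnegrE ?addr_ge0 ?norm2_ge0//.
rewrite sqrrD !norm2_sqr !dotE (dotC v u).
by have := dot_le_norm2 u v; lra.
Qed.

Lemma norm2D {n} (u v : 'cV[R]_n) : norm2 (u + v) <= norm2 u + norm2 v.
Proof. by rewrite -norm2_tr -(norm2_tr u) -(norm2_tr v) linearD norm2D_rV. Qed.

Lemma entry_le_norm2 {m n} (A : 'M[R]_(m, n)) i j : `|A i j| <= norm2 A.
Proof.
rewrite -(@ler_pXn2r _ 2)// ?nnegrE ?norm2_ge0// sqr_norm2 real_normK ?num_real//.
rewrite (bigD1 i)//= (bigD1 j)//= -addrA lerDl addr_ge0//.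
  by apply: sumr_ge0 => k _; exact: sqr_ge0.
by do 2 (apply: sumr_ge0 => ? _); exact: sqr_ge0.
Qed.

Lemma norm2_le_entries {m n} (A : 'M[R]_(m, n)) (c : R) : 0 <= c ->
  (forall i j, `|A i j| <= c) -> norm2 A ^+ 2 <= (m * n)%:R * c ^+ 2.
Proof.
move=> c0 h; rewrite sqr_norm2.
apply: (@le_trans _ _ (\sum_(i < m) \sum_(j < n) c ^+ 2)); last first.
  by rewrite !sumr_const !card_ord -mulrnA mulr_natl mulnC.
apply: ler_sum => i _; apply: ler_sum => j _.
by rewrite -(real_normK (num_real (A i j))) lerXn2r ?nnegrE.
Qed.

Lemma norm2_mulmx_frobenius {m n} (A : 'M[R]_(m, n)) (v : 'cV[R]_n) :
  norm2 (A *m v) <= norm2 A * norm2 v.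
Proof.
rewrite -(@ler_pXn2r _ 2)// ?nnegrE ?mulr_ge0 ?norm2_ge0//.
rewrite exprMn !sqr_norm2 mulr_suml; apply: ler_sum => i _.
rewrite big_ord1 mxE.
have := cauchy_schwarz (row i A) v^T.
rewrite /dot; under eq_bigr => j _ do rewrite !mxE.
under [X in _ <= X * _ -> _]eq_bigr => j _ do rewrite !mxE -expr2.
under [X in _ <= _ * X -> _]eq_bigr => j _ do rewrite !mxE -expr2.
by under [X in _ -> _ <= _ * X]eq_bigr => j _ do rewrite big_ord1.
Qed.

(** A supremum dominates the elements of a set only if the set is bounded; here
    the Frobenius norm is a bound. *)
Lemma norm2_mulmx_opnorm {m n} (A : 'M[R]_(m, n)) (v : 'cV[R]_n) :
  norm2 (A *m v) <= opnorm2 A * norm2 v.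
Proof.
have [/norm2_eq0 ->|v0] := eqVneq (norm2 v) 0.
  have -> : norm2 (0 : 'cV[R]_n) = 0.
    by rewrite -(scale0r (0 : 'cV[R]_n)) norm2Z normr0 mul0r.
  by rewrite mulmx0 mulr0 -(scale0r (0 : 'cV[R]_m)) norm2Z normr0 mul0r.
have vp : 0 < norm2 v by rewrite lt_def v0 norm2_ge0.
rewrite -ler_pdivrMr//.
have -> : norm2 (A *m v) / norm2 v = norm2 (A *m ((norm2 v)^-1 *: v)).
  by rewrite -scalemxAr norm2Z normfV ger0_norm ?norm2_ge0// mulrC.
apply: ub_le_sup; last first.
  exists ((norm2 v)^-1 *: v) => //=.
  by rewrite norm2Z normfV ger0_norm ?norm2_ge0// mulVf.
exists (norm2 A) => _ [u /= u1 <-].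
apply: (le_trans (norm2_mulmx_frobenius A u)).
by rewrite ler_piMr// norm2_ge0.
Qed.
End Norm2.

Section Consensus.
Context {R : realType} {n : nat}.
Variable W : 'M[R]_n.
Hypotheses (n0 : (0 < n)%N) (W1 : W *m const_mx 1 = const_mx 1 :> 'cV[R]_n)
  (oneW : const_mx 1 *m W = const_mx 1 :> 'rV[R]_n).

Definition averaging : 'M[R]_n := n%:R^-1 *: const_mx 1.

Lemma averagingE (v : 'cV[R]_n) i j : (averaging *m v) i j = n%:R^-1 * \sum_k v k 0.
Proof.
rewrite /averaging -scalemxAl mxE (ord1 j); congr (_ * _); rewrite mxE.
by apply: eq_bigr => k _; rewrite mxE mul1r.
Qed.

Lemma averaging_mixing (v : 'cV[R]_n) : averaging *m (W *m v) = averaging *m v.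
Proof.
suff -> : averaging *m (W *m v) = (averaging *m W) *m v.
  congr (_ *m _); rewrite /averaging -scalemxAl; congr (_ *: _).
  apply/matrixP => i j; rewrite !mxE.
  have /matrixP/(_ 0 j) := oneW; rewrite !mxE => h1; rewrite -[RHS]h1.
  by apply: eq_bigr => k _; rewrite !mxE.
by rewrite mulmxA.
Qed.

(** Mixing fixes constant vectors and preserves averages, so on deviations from
    the average it acts as W - averaging. *)
Lemma mixing_contracts (v w : 'cV[R]_n) : 0 <= opnorm2 (W - averaging) ->
  norm2 (W *m (v - w) - averaging *m (W *m (v - w))) <=
    opnorm2 (W - averaging) * (norm2 (v - averaging *m v) + norm2 w).
Proof.
move=> lam0; have n1 : n%:R != 0 :> R by rewrite pnatr_eq0 -lt0n.
have JJ : averaging *m averaging = averaging.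
  rewrite {1}/averaging -scalemxAl; congr (_ *: _); apply/matrixP => i j.
  rewrite !mxE; under eq_bigr => k _ do rewrite !mxE mulr1 mul1r.
  by rewrite sumr_const card_ord -[LHS]mulr_natl mulfV.
have WJ : W *m averaging = averaging.
  rewrite /averaging -scalemxAr; congr (_ *: _); apply/matrixP => i j.
  have /matrixP/(_ i 0) := W1; rewrite !mxE => h1; rewrite -[RHS]h1.
  by apply: eq_bigr => k _; rewrite !mxE.
have WJJ : (W - averaging) *m averaging = 0 by rewrite mulmxBl WJ JJ subrr.
have -> : W *m (v - w) - averaging *m (W *m (v - w)) =
    (W - averaging) *m ((v - averaging *m v) - w).
  rewrite averaging_mixing -mulmxBl (addrAC v) [RHS]mulmxBr (mulmxA _ averaging).
  by rewrite WJJ mul0mx subr0.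
apply: (le_trans (norm2_mulmx_opnorm _ _)); apply: ler_wpM2l.
  exact: lam0.
by apply: (le_trans (norm2D _ _)); rewrite norm2N.
Qed.
End Consensus.

(* Hypotheses and closed forms come before the product and sum rules, which also
   match powers and defined constants up to unfolding. *)
Ltac nonneg := repeat first
  [ assumption | apply: ltW; assumption | by [] | exact: sqr_ge0 | exact: sqrtr_ge0
  | exact: norm2_ge0 | exact: normr_ge0 | exact: ler0n | apply: exprn_ge0
  | rewrite invr_ge0 | apply: mulr_ge0 | apply: addr_ge0 ].

(** * Independence of the past and the present *)

Lemma integrable_bounded {R : realType} {dT : measure_display}
    {T : measurableType dT} (P : probability T R) (h : T -> R) (M : R) :
  measurable_fun setT h -> (forall x, `|h x| <= M) ->
  P.-integrable setT (EFin \o h).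
Proof.
move=> mh hM; apply: measurable_bounded_integrable => //.
  apply: (@le_lt_trans _ _ 1%E); last by rewrite ltry.
  exact: probability_le1.
exists M; split; first exact: num_real.
by move=> x Mx y _; apply: (le_trans (hM y)); exact: ltW.
Qed.

Section Independence.
Context {R : realType} {dT : measure_display} {T : measurableType dT}.
Variable P : probability T R.

(** Intersections of one event per earlier step: unlike the union of the
    sigma-algebras, this is a pi-system. *)
Definition past (G : nat -> set_system T) (t : nat) : set_system T :=
  [set B | exists A : nat -> set T, (forall i, i \in iota 0 t -> G i (A i)) /\
                          B = \bigcap_(i in [set` iota 0 t]) A i].

Lemma past_setI_closed (G : nat -> set_system T) (t : nat) :
  (forall i, setI_closed (G i)) -> setI_closed (past G t).
Proof.
move=> GI _ _ [A [GA ->]] [B [GB ->]]; exists (fun i => A i `&` B i); split.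
  by move=> i it; apply: GI; [exact: GA|exact: GB].
by rewrite bigcapI.
Qed.

Lemma past_measurable (G : nat -> set_system T) (t : nat) :
  (forall i, G i `<=` measurable) -> past G t `<=` measurable.
Proof.
move=> Gm _ [A [GA ->]]; apply: bigcap_measurableType => i it; by apply: (Gm i); apply: GA.
Qed.

(** As functions of A, both sides are finite measures which agree on the
    pi-system [past G t] by mutual independence. *)
Lemma independent_past (G : nat -> set_system T) (t : nat) (A C : set T) :
  mutually_independent P G -> (forall i, G i `<=` measurable) ->
  (forall i, setI_closed (G i)) -> (forall i, G i setT) ->
  <<s past G t >> A -> G t C -> P (A `&` C) = (P A * P C)%E.
Proof.
move=> Gind Gm GI GT sA GC.
have mC : measurable C by exact: (Gm t).
have PC0 : (0 <= fine (P C))%R by exact: fine_ge0.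
pose m1 := mrestr P mC.
pose m2 := mscale (NngNum PC0) P.
suff -> : P (A `&` C) = m2 A.
  by rewrite /m2 /mscale /= fineK 1?muleC// fin_num_measure.
change (P (A `&` C)) with (m1 A).
apply: (g_sigma_algebra_measure_unique (past G t) _ (fun=> setT)) => //.
- exact: past_measurable.
- move=> _; exists (fun=> setT); split=> //.
  by apply/seteqP; split=> // x _ i _.
- by apply/seteqP; split=> // x _; exists 0%N.
- exact: past_setI_closed.
- move=> _ [B [GB ->]].
  pose B' i := if i == t then C else B i.
  have := Gind (rcons (iota 0 t) t) B'.
  rewrite rcons_uniq iota_uniq mem_iota add0n ltnn /= => /(_ isT).
  have hB i : i \in rcons (iota 0 t) t -> G i (B' i).
    rewrite /B' mem_rcons inE; case: eqP => [-> //|_ /=]; exact: GB.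
  move=> /(_ hB).
  have Bi i : i \in iota 0 t -> B' i = B i.
    by rewrite /B' mem_iota add0n; case: eqP => // ->; rewrite ltnn andbF.
  have -> : \bigcap_(i in [set` rcons (iota 0 t) t]) B' i =
            (\bigcap_(i in [set` iota 0 t]) B i) `&` C.
    apply/seteqP; split => x.
      move=> h; split.
        by move=> i /= it; rewrite -(Bi i it); apply: h; rewrite /= mem_rcons inE it orbT.
      by have := h t; rewrite /B' eqxx; apply; rewrite /= mem_rcons inE eqxx.
    move=> [h1 h2] i /=; rewrite mem_rcons inE /B'; case: eqP => //= _ it.
    exact: h1.
  rewrite /m1 /mrestr => ->; rewrite -cats1 big_cat /= big_seq1.
  rewrite /m2 /mscale /= fineK ?fin_num_measure// muleC; congr (_ * _)%E.
    by rewrite /B' eqxx.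
  under eq_big_seq => i it do rewrite Bi//.
  by rewrite (Gind (iota 0 t) B (iota_uniq _ _) GB).
- move=> k; apply: (@le_lt_trans _ _ 1%E); last by rewrite ltry.
  by apply: probability_le1; exact: measurableI.
Qed.

(** The joint law is the product of the laws, and Fubini's theorem applies. The
    function is only bounded along the values of X and Y, so that it may be a
    product with a factor that is unbounded off their range. *)
Lemma expectation_independent {dS dV : measure_display}
    {S : measurableType dS} {V : measurableType dV}
    (X : T -> S) (Y : T -> V) (f : S * V -> R) (M : R) :
  measurable_fun setT X -> measurable_fun setT Y ->
  (forall A B, measurable A -> measurable B ->
     P (X @^-1` A `&` Y @^-1` B) = (P (X @^-1` A) * P (Y @^-1` B))%E) ->
  measurable_fun setT f -> (forall w w', `|f (X w, Y w')| <= M) ->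
  \int[P]_w f (X w, Y w) = \int[P]_w (\int[P]_w' f (X w, Y w')).
Proof.
move=> mX mY XY mf bf.
pose Z w := (X w, Y w).
have mZ : measurable_fun setT Z by exact: measurable_fun_pair.
pose PX := [the probability _ _ of distribution P (mfun_Sub (mem_set mX))].
pose PY := [the probability _ _ of distribution P (mfun_Sub (mem_set mY))].
pose PZ := [the probability _ _ of distribution P (mfun_Sub (mem_set mZ))].
have PZE B : measurable B -> (PX \x PY)%E B = PZ B.
  move=> mB; exact: product_measure_unique.
have ifZ : P.-integrable setT (fun w => (f (X w, Y w))%:E).
  apply: (@integrable_bounded _ _ _ _ (f \o Z) M) => [|x]; last exact: bf.
  exact: measurableT_comp.
have ifY w : P.-integrable setT (fun w' => (f (X w, Y w'))%:E).
  apply: (@integrable_bounded _ _ _ _ (fun w' => f (X w, Y w')) M) => [|x]; last exact: bf.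
  by apply: measurableT_comp => //; exact: measurable_fun_pair.
have /measurable_EFinP mEf := mf.
have ifXY : (PX \x PY)%E.-integrable setT (fun z => (f z)%:E).
  apply/integrableP; split=> //.
  have -> : (\int[PX \x PY]_z `|(f z)%:E| = \int[PZ]_z `|(f z)%:E|)%E.
    by apply: eq_measure_integral => /= A mA _; rewrite PZE.
  have mabs : measurable_fun setT (fun z => `|(f z)%:E|%E) by exact: measurableT_comp.
  by rewrite (ge0_integral_distribution _ mabs)//=; have /integrableP[] := ifZ.
rewrite /Rintegral; congr fine.
transitivity (\int[PZ]_z (f z)%:E)%E.
  by rewrite integral_distribution.
transitivity (\int[PX \x PY]_z (f z)%:E)%E.
  by apply: eq_measure_integral => /= A mA _; rewrite PZE.
rewrite -(integral12_prod_meas1 ifXY) /fubini_F.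
rewrite integral_distribution//=; last 2 first.
- exact: (measurable_fubini_F ifXY).
- have mF : measurable_fun setT (fun x : S => \int[PY]_y (f (x, y))%:E)%E.
    exact: (measurable_fubini_F ifXY).
  apply/integrableP; split; first exact: measurableT_comp mF mX.
  have /integrableP[_] := integrable_fubini_F ifXY.
  rewrite ge0_integral_distribution//=; exact: measurableT_comp.
apply: eq_integral => w _.
rewrite fineK; last first.
  exact: integrable_fin_num.
rewrite integral_distribution//=; last exact: ifY.
by apply: measurableT_comp => //; exact: measurableT_comp.
Qed.
End Independence.

(** * Continuous functions of random vectors *)

Section ContinuousMeasurable.
Context {R : realType} {dT : measure_display} {T : measurableType dT}.

(** The preimage of an open ray by g is a countable union of boxes with rational
    centre and radius 1/(k+1), and the preimage of a box by X is a finite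
    intersection of coordinate events. *)
Lemma measurable_fun_continuous_rV {n : nat} (g : 'rV[R]_n -> R) (X : T -> 'rV[R]_n) :
  continuous g -> (forall k, measurable_fun setT (fun w => X w 0 k)) ->
  measurable_fun setT (fun w => g (X w)).
Proof.
move=> cg mX mT; apply: (measurability _ (RGenOInfty.measurableE R)) => //.
move=> /= _ [_ [a ->] <-]; rewrite setTI.
pose B (qe : 'rV[rat]_n * nat) := ball (map_mx (@ratr R) qe.1) (qe.2.+1%:R^-1 : R).
pose F qe := if `[< B qe `<=` g @^-1` `]a, +oo[ >] then X @^-1` B qe else set0.
rewrite [X in measurable X](_ : _ = \bigcup_qe F qe).
  apply: countable_bigcupT_measurable => [|qe]; first exact: countableP.
  rewrite /F; case: ifPn => // _.
  rewrite [X in measurable X](_ : _ = \bigcap_(k : 'I_n) ((fun w => X w 0 k) @^-1`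
      (ball (ratr (qe.1 0 k) : R) (qe.2.+1%:R^-1 : R)))).
    apply: fin_bigcap_measurable => [|k _]; first exact: finite_finset.
    rewrite -[X in measurable X]setTI; apply: mX => //.
    by apply: open_measurable; exact: ball_open.
  apply/seteqP; split => w /=.
    by move=> [_ h] k _; have := h ord0 k; rewrite mxE.
  by move=> h; split=> // i k; rewrite mxE (ord1 i); exact: h.
apply/seteqP; split => [w|w [qe _]]; last first.
  by rewrite /F; case: asboolP => // h; exact: h.
move=> gw.
have : nbhs (X w) (g @^-1` `]a, +oo[).
  by apply: cg; apply: open_nbhs_nbhs; split=> //; exact: itv_open.
move=> /nbhs_ballP [e /= e0 he].
have [k ke] : exists k : nat, k.+1%:R^-1 < e / 2.
  have := near_infty_natSinv_lt (PosNum (divr_gt0 e0 (ltr0Sn R 1))).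
  by case=> N _ /(_ N (leqnn N)) /= h; exists N.
have /choice [q hq] : forall j : 'I_n, exists q : rat,
    `|X w 0 j - ratr q| < (k.+1%:R^-1 : R).
  move=> j.
  have lt : X w 0 j - k.+1%:R^-1 < X w 0 j + k.+1%:R^-1.
    by rewrite ltrD2l gtrN // invr_gt0.
  have [q] := rat_in_itvoo lt; rewrite in_itv /= => /andP[h1 h2].
  by exists q; rewrite ltr_distlC h1.
exists (\row_j q j, k) => //; rewrite /F ifT.
  by split=> // i j; rewrite !mxE (ord1 i) /ball /= distrC.
apply/asboolP => y [_ hy]; apply: he; split=> // i j.
have := hy ord0 j; rewrite !mxE (ord1 i) /ball /= => hqy.
by rewrite (splitr e) (le_lt_trans (ler_distD (ratr (q j)) _ _))// ltrD// (lt_trans _ ke).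
Qed.
End ContinuousMeasurable.

(** * Real random variables with a density *)

Section Density.
Context {R : realType} {dT : measure_display} {T : measurableType dT}.
Variable P : probability T R.
Local Notation mu := (@lebesgue_measure R).

(** The density is almost everywhere the Radon-Nikodym derivative of the law. *)
Lemma ge0_integral_density (X : {RV P >-> R}) (p : R -> R) (f : R -> \bar R) :
  measurable_fun setT p -> (forall u, 0 <= p u) -> has_density X p ->
  measurable_fun setT f -> (forall u, 0 <= f u)%E ->
  (\int[P]_w f (X w) = \int[mu]_u (f u * (p u)%:E))%E.
Proof.
move=> mp p0 Xp mf f0.
have mEp : measurable_fun [set: measurableTypeR R] (fun u => (p u)%:E) by exact/measurable_EFinP.
(* The Borel structure carrying Lebesgue measure has the same measurable sets as
   the one carrying the law of X, but is another instance. *)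
have mX : measurable_fun setT (X : T -> measurableTypeR R).
  by move=> mT A mA; exact: (measurable_funPT X).
pose Y : {RV P >-> measurableTypeR R} := @mfun_Sub _ _ T (measurableTypeR R) X (mem_set mX).
pose nu := [the probability _ _ of distribution P Y].
have nuE A : nu A = distribution P X A by [].
have numu : nu `<< mu.
  apply/null_content_dominatesP => A mA muA; rewrite nuE (Xp A mA).
  by apply: null_set_integral => //; exact: measurable_funTS.
have mf' : measurable_fun [set: measurableTypeR R] f by move=> mT A mA; exact: mf.
rewrite -(ge0_integral_distribution Y mf' f0).
rewrite -(Radon_Nikodym_SigmaFinite.change_of_variables numu f0 measurableT mf').
have h := integral_ae_eq measurableT
  (Radon_Nikodym_SigmaFinite.f_integrable numu) mEp.
apply: ge0_ae_eq_integral => //.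
- apply: emeasurable_funM => //.
  exact: measurable_int (Radon_Nikodym_SigmaFinite.f_integrable numu).
- exact: emeasurable_funM.
- by move=> u _; rewrite mule_ge0 ?f0// Radon_Nikodym_SigmaFinite.f_ge0.
- by move=> u _; rewrite mule_ge0 ?f0// lee_fin.
- have : ae_eq mu setT (Radon_Nikodym_SigmaFinite.f nu mu) (EFin \o p); last first.
    by apply: filterS => u h1 _; rewrite h1.
  apply: h => E _ mE.
  by rewrite -(Radon_Nikodym_SigmaFinite.f_integral numu mE); exact: (Xp E mE).
Qed.

Lemma integral_lebesgueN (g : R -> \bar R) :
  measurable_fun setT g -> (forall u, 0 <= g u)%E ->
  (\int[mu]_u g u = \int[mu]_u g (- u)%R)%E.
Proof.
move=> mg g0.
have mN : measurable_fun setT (-%R : R -> R) by exact: oppr_measurable.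
transitivity (\int[pushforward mu (-%R : _ -> measurableTypeR R)]_u g u)%E.
  by apply: eq_measure_integral => //= A mA _; exact/esym/lebesgue_measureN.
by rewrite ge0_integral_pushforward.
Qed.

(** Under an even density the positive and the negative part of an odd function
    have the same integral, by the change of variables u -> -u. *)
Lemma expectation_odd (X : {RV P >-> R}) (p : R -> R) (h : R -> R) (M : R) :
  measurable_fun setT p -> (forall u, 0 <= p u) -> has_density X p ->
  (forall u, p u = p (- u)) ->
  measurable_fun setT h -> (forall u, `|h u| <= M) -> (forall u, h (- u) = - h u) ->
  \int[P]_w h (X w) = 0.
Proof.
move=> mp p0 Xp pN mh hM hN.
have mEh : measurable_fun [set: measurableTypeR R] (fun u => (h u)%:E) by exact/measurable_EFinP.
have mEp : measurable_fun [set: measurableTypeR R] (fun u => (p u)%:E) by exact/measurable_EFinP.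
rewrite /Rintegral integralE.
have -> : (\int[P]_w (fun w => (h (X w))%:E)^\+ w = \int[P]_w (fun w => (h (X w))%:E)^\- w)%E.
  have mhp := measurable_funepos mEh; have mhn := measurable_funeneg mEh.
  rewrite (_ : (fun w => (h (X w))%:E)^\+%E = (EFin \o h)^\+%E \o X); last first.
    by apply/funext => w /=; rewrite !funeposE.
  rewrite (_ : (fun w => (h (X w))%:E)^\-%E = (EFin \o h)^\-%E \o X); last first.
    by apply/funext => w /=; rewrite !funenegE.
  rewrite (ge0_integral_density mp p0 Xp mhp)//.
  rewrite (ge0_integral_density mp p0 Xp mhn)//.
  rewrite integral_lebesgueN; last 2 first.
  - exact: emeasurable_funM.
  - by move=> u; rewrite mule_ge0// lee_fin.
  apply: eq_integral => u _; rewrite -pN; congr (_ * _)%E.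
  by rewrite funeposE funenegE /= hN EFinN.
rewrite subee //; apply: (@integrable_fin_num _ _ _ P) => //.
apply: integrable_funeneg => //; apply: (@integrable_bounded _ _ _ P (h \o X) M) => [|w].
  exact: measurableT_comp.
exact: hM.
Qed.

Lemma expectation_normr_density (X : {RV P >-> R}) (p : R -> R) (s : R) :
  measurable_fun setT p -> (forall u, 0 <= p u) -> has_density X p ->
  (\int[mu]_u (`|u| * p u)%:E <= s%:E)%E ->
  P.-integrable setT (fun w => `|X w|%:E) /\ \int[P]_w `|X w| <= s.
Proof.
move=> mp p0 Xp ps.
have E : (\int[P]_w `|X w|%:E = \int[mu]_u (`|u| * p u)%:E)%E.
  rewrite (ge0_integral_density (f := fun u => `|u|%:E) mp p0 Xp)//.
  by apply/measurable_EFinP.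
have I : P.-integrable setT (fun w => `|X w|%:E).
  apply/integrableP; split.
    by apply/measurable_EFinP; apply: measurableT_comp.
  under eq_integral do rewrite gee0_abs//.
  by rewrite E (le_lt_trans ps)// ltry.
split=> //; rewrite -lee_fin /Rintegral fineK ?E//.
by rewrite -E; exact: integrable_fin_num.
Qed.
End Density.

(** * Bounded random variables and the averaged clipping *)

Section BoundedExpectation.
Context {R : realType} {dT : measure_display} {T : measurableType dT}.
Variable P : probability T R.
Implicit Types (g h : T -> R).

Definition bounded_measurable h : Prop :=
  measurable_fun setT h /\ exists M, forall w, `|h w| <= M.

Lemma bounded_measurable_integrable h : bounded_measurable h ->
  P.-integrable setT (EFin \o h).
Proof. by move=> [mh [M hM]]; exact: integrable_bounded hM. Qed.

Lemma bounded_measurable_cst c : bounded_measurable (fun=> c).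
Proof. by split; [exact: measurable_cst|exists `|c|]. Qed.

Lemma bounded_measurableD g h : bounded_measurable g -> bounded_measurable h ->
  bounded_measurable (fun w => g w + h w).
Proof.
move=> [mg [M gM]] [mh [N hN]]; split; first exact: measurable_funD.
by exists (M + N) => w; rewrite (le_trans (ler_normD _ _))// lerD.
Qed.

Lemma bounded_measurableM g h : bounded_measurable g -> bounded_measurable h ->
  bounded_measurable (fun w => g w * h w).
Proof.
move=> [mg [M gM]] [mh [N hN]]; split; first exact: measurable_funM.
by exists (M * N) => w; rewrite normrM ler_pM.
Qed.

Lemma bounded_measurableZ c h : bounded_measurable h ->
  bounded_measurable (fun w => c * h w).
Proof. by move=> bh; apply: bounded_measurableM => //; exact: bounded_measurable_cst. Qed.

Lemma bounded_measurable_sum (I : finType) (h : I -> T -> R) :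
  (forall i, bounded_measurable (h i)) -> bounded_measurable (fun w => \sum_i h i w).
Proof.
move=> bh; elim: (index_enum I) => [|i s IH].
  by under eq_fun do rewrite big_nil; exact: bounded_measurable_cst.
by under eq_fun do rewrite big_cons; exact: bounded_measurableD.
Qed.

Lemma bounded_expectation_sum (I : finType) (h : I -> T -> R) :
  (forall i, bounded_measurable (h i)) ->
  \int[P]_w (\sum_i h i w) = \sum_i \int[P]_w h i w.
Proof.
move=> bh.
suff [] : bounded_measurable (fun w => \sum_i h i w) /\
   \int[P]_w (\sum_i h i w) = \sum_i \int[P]_w h i w by [].
elim: (index_enum I) => [|i s [IH1 IH2]].
  split; first by under eq_fun do rewrite big_nil; exact: bounded_measurable_cst.
  rewrite big_nil; under eq_Rintegral do rewrite big_nil.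
  by rewrite Rintegral_cst// mul0r.
split; first by under eq_fun do rewrite big_cons; exact: bounded_measurableD.
rewrite big_cons -IH2; under eq_Rintegral do rewrite big_cons.
by rewrite RintegralD//; exact: bounded_measurable_integrable.
Qed.

Lemma bounded_expectationZ c h : bounded_measurable h ->
  \int[P]_w (c * h w) = c * \int[P]_w h w.
Proof. by move=> bh; rewrite RintegralZl//; exact: bounded_measurable_integrable. Qed.

Lemma bounded_expectationD g h : bounded_measurable g -> bounded_measurable h ->
  \int[P]_w (g w + h w) = \int[P]_w g w + \int[P]_w h w.
Proof. by move=> bg bh; rewrite RintegralD//; exact: bounded_measurable_integrable. Qed.

Lemma Rintegral_probability_cst c : \int[P]_w c = c.
Proof.
by rewrite Rintegral_cst// [X in fine X](_ : _ = 1%E) ?mulr1//; exact: probability_setT.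
Qed.

Lemma bounded_expectation_le g h : bounded_measurable g -> bounded_measurable h ->
  (forall w, g w <= h w) -> \int[P]_w g w <= \int[P]_w h w.
Proof.
by move=> bg bh gh; apply: le_Rintegral => //; exact: bounded_measurable_integrable.
Qed.

Lemma normr_expectation_le h g : bounded_measurable h ->
  P.-integrable setT (EFin \o g) -> (forall w, `|h w| <= g w) ->
  `|\int[P]_w h w| <= \int[P]_w g w.
Proof.
move=> bh ig hg; have ih := bounded_measurable_integrable bh.
apply: (le_trans (le_normr_Rintegral measurableT ih)).
apply: le_Rintegral => //.
have [mh [M hM]] := bh.
apply: (@integrable_bounded _ _ _ _ (fun w => `|h w|) M) => [|w].
  exact: measurableT_comp.
by rewrite normr_id.
Qed.
End BoundedExpectation.

Section SmoothedClipping.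
Context {R : realType} {dT : measure_display} {T : measurableType dT}.
Variables (P : probability T R) (V : {RV P >-> R}) (sigma phi eps : R).
Hypotheses (phi0 : 0 <= phi) (eps0 : 0 < eps).
Hypothesis V_abs : P.-integrable setT (fun w => `|V w|%:E) /\ \int[P]_w `|V w| <= sigma.
Hypothesis V_odd : forall (h : R -> R) (M : R), measurable_fun setT h ->
  (forall u, `|h u| <= M) -> (forall u, h (- u) = - h u) -> \int[P]_w h (V w) = 0.

(** Mean of the clipped oracle answer when its noiseless part is a. *)
Definition smoothed_clip (a : R) : R := \int[P]_w sclip phi eps (a + V w).

Lemma bounded_measurable_sclip (g : T -> R) : measurable_fun setT g ->
  bounded_measurable (fun w => sclip phi eps (g w)).
Proof.
move=> mg; split; last by exists phi => w; exact: sclip_bound.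
by apply: measurableT_comp => //; apply: continuous_measurable_fun; exact: continuous_sclip.
Qed.

Let bm a : bounded_measurable (fun w => sclip phi eps (a + V w)).
Proof.
apply: bounded_measurable_sclip; apply: measurable_funD; first exact: measurable_cst.
exact: measurable_funPT.
Qed.

Lemma smoothed_clip0 : smoothed_clip 0 = 0.
Proof.
rewrite /smoothed_clip; under eq_Rintegral do rewrite add0r.
apply: (V_odd (M := phi)) => [|u|u]; last exact: sclipN.
- by apply: continuous_measurable_fun; exact: continuous_sclip.
- exact: sclip_bound.
Qed.

Lemma smoothed_clipB a b :
  smoothed_clip a - smoothed_clip b =
  \int[P]_w (sclip phi eps (a + V w) - sclip phi eps (b + V w)).
Proof. by rewrite /smoothed_clip RintegralB//; exact: bounded_measurable_integrable. Qed.

Lemma smoothed_clip_lipschitz a b :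
  `|smoothed_clip a - smoothed_clip b| <= phi / Num.sqrt eps * `|a - b|.
Proof.
rewrite smoothed_clipB -[leRHS](Rintegral_probability_cst P).
apply: normr_expectation_le => [||w].
- apply: bounded_measurableD => //.
  under eq_fun do rewrite -mulN1r; exact: bounded_measurableZ.
- exact/bounded_measurable_integrable/bounded_measurable_cst.
- apply: (le_trans (sclip_lipschitz _ _ phi0 eps0)).
  by rewrite opprD addrACA subrr addr0.
Qed.

(** The mean of [sclip_linearization] over the noise. The relative error is
    small as soon as sqrt(eps) is large against M and sigma. *)
Lemma smoothed_clip_linearization M a b : `|a| <= M -> `|b| <= M ->
  `|smoothed_clip a - smoothed_clip b - phi / Num.sqrt eps * (a - b)| <=
  phi / Num.sqrt eps * (3 * M ^+ 2 / eps + 2 * sigma / Num.sqrt eps) * `|a - b|.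
Proof.
move=> aM bM; set K := phi / Num.sqrt eps.
have K0 : 0 <= K by rewrite divr_ge0// sqrtr_ge0.
have bd : bounded_measurable (fun w => sclip phi eps (a + V w) - sclip phi eps (b + V w)).
  apply: bounded_measurableD => //.
  under eq_fun do rewrite -mulN1r; exact: bounded_measurableZ.
rewrite smoothed_clipB -[X in _ - X](Rintegral_probability_cst P) -RintegralB//; last 2 first.
- exact: bounded_measurable_integrable.
- exact/bounded_measurable_integrable/bounded_measurable_cst.
have [iV sV] := V_abs.
have iV' c : P.-integrable setT (EFin \o (fun w => c * `|V w|)).
  by rewrite (_ : EFin \o _ = (fun w => c%:E * `|V w|%:E)%E)//; exact: integrableZl.
pose g w := K * `|a - b| * (3 * M ^+ 2 / eps) + K * `|a - b| * 2 / Num.sqrt eps * `|V w|.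
apply: (@le_trans _ _ (\int[P]_w g w)).
  apply: normr_expectation_le => [||w].
  - by apply: bounded_measurableD => //; exact: bounded_measurable_cst.
  - rewrite (_ : EFin \o _ = ((EFin \o (fun=> (K * `|a - b| * (3 * M ^+ 2 / eps))%R)) \+
      (EFin \o (fun w => (K * `|a - b| * 2 / Num.sqrt eps * `|V w|)%R)))%E)//.
    by apply: integrableD => //; exact/bounded_measurable_integrable/bounded_measurable_cst.
  - apply: (le_trans (sclip_linearization _ phi0 eps0 aM bM)).
    by rewrite /g le_eqVlt; apply/orP; left; apply/eqP; rewrite -/K; ring.
rewrite /g RintegralD//; last exact/bounded_measurable_integrable/bounded_measurable_cst.
rewrite Rintegral_probability_cst RintegralZl//.
have : K * `|a - b| * 2 / Num.sqrt eps * \int[P]_w `|V w| <=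
       K * `|a - b| * 2 / Num.sqrt eps * sigma.
  by rewrite ler_wpM2l// !mulr_ge0// invr_ge0 sqrtr_ge0.
lra.
Qed.
End SmoothedClipping.

(** * Bounds valid along every noise path *)

Section Dynamics.
Context {R : realType} {n d : nat}.
Variables (f : 'I_n -> 'rV[R]_d -> R) (W : 'M[R]_n) (cphi tau ceta cbeta : R)
  (x0 xs : 'rV[R]_d).
Hypotheses (n0 : (0 < n)%N) (cphi0 : 0 < cphi) (tau0 : 0 < tau) (ceta0 : 0 < ceta)
  (cbeta01 : 0 <= cbeta < 1).
Local Notation r := (@scale R).

Definition clip_level (t : nat) : R := cphi / r t ^+ 5.
Definition smoothing (t : nat) : R := tau * r t ^+ 6.
Definition momentum_weight (t : nat) : R := cbeta / r t ^+ 5.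
Definition step_size (t : nat) : R := ceta / r t ^+ 2.
Local Notation phi := clip_level.
Local Notation eps := smoothing.
Local Notation beta := momentum_weight.
Local Notation eta := step_size.

Implicit Types (z : nat -> 'I_n -> 'rV[R]_d) (t : nat) (i : 'I_n) (k : 'I_d).

Definition iterate z t i := (sclip_ef_network f W phi eps beta eta x0 z t).1 i.
Definition momentum z t i := (sclip_ef_network f W phi eps beta eta x0 z t).2 i.
(** Argument of the clipping, without the noise. *)
Definition residual z t i := grad (f i) (iterate z t i) - momentum z t i.
Definition mean_iterate z t := n%:R^-1 *: \sum_i iterate z t i.
Definition mean_momentum z t := n%:R^-1 *: \sum_i momentum z t i.

Lemma momentumS z t i : momentum z t.+1 i = beta t *: momentum z t i +
  (1 - beta t) *: map_mx (sclip (phi t) (eps t)) (residual z t i + z t i).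
Proof.
rewrite /residual /momentum /iterate /=.
case: (sclip_ef_network _ _ _ _ _ _ _ _ t) => x m /=.
by rewrite addrAC.
Qed.

Lemma iterateS z t i : iterate z t.+1 i =
  \sum_j W i j *: (iterate z t j - eta t *: momentum z t.+1 j).
Proof.
rewrite /momentum /iterate /=.
by case: (sclip_ef_network _ _ _ _ _ _ _ _ t) => x m /=.
Qed.

Lemma residual_coord z t i k :
  residual z t i 0 k = grad (f i) (iterate z t i) 0 k - momentum z t i 0 k.
Proof. by rewrite mxE [X in _ + X]mxE. Qed.

Lemma momentumS_coord z t i k : momentum z t.+1 i 0 k = beta t * momentum z t i 0 k +
  (1 - beta t) * sclip (phi t) (eps t) (residual z t i 0 k + z t i 0 k).
Proof.
rewrite momentumS mxE [X in X + _]mxE [X in _ + X]mxE; congr (_ + _ * _).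
by rewrite mxE [X in sclip _ _ X]mxE.
Qed.

Lemma clip_level_gt0 t : 0 < phi t. Proof. by rewrite divr_gt0// exprn_gt0// scale_gt0. Qed.
Lemma smoothing_gt0 t : 0 < eps t. Proof. by rewrite mulr_gt0// exprn_gt0// scale_gt0. Qed.
Lemma step_size_gt0 t : 0 < eta t. Proof. by rewrite divr_gt0// exprn_gt0// scale_gt0. Qed.
Lemma momentum_weight_ge0 t : 0 <= beta t.
Proof. by case/andP: cbeta01 => h _; rewrite divr_ge0// exprn_ge0// ltW// scale_gt0. Qed.
Lemma momentum_weight_le t : beta t <= cbeta.
Proof.
case/andP: cbeta01 => h _; rewrite ler_pdivrMr ?exprn_gt0 ?scale_gt0//.
by rewrite ler_peMr// scaleX_ge1.
Qed.
Lemma momentum_weight_lt1 t : beta t < 1.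
Proof. by apply: (le_lt_trans (momentum_weight_le t)); case/andP: cbeta01. Qed.

(** Fixed point of q = cbeta q + cphi, hence an invariant bound on the
    momentum. *)
Definition momentum_const : R := cphi / (1 - cbeta).
Local Notation Q := momentum_const.

Lemma momentum_const_gt0 : 0 < Q.
Proof. by case/andP: cbeta01 => _ h; rewrite divr_gt0// subr_gt0. Qed.

Lemma momentum_step z t i k :
  `|momentum z t.+1 i 0 k| <= beta t * `|momentum z t i 0 k| + phi t.
Proof.
rewrite momentumS_coord; apply: (le_trans (ler_normD _ _)).
rewrite normrM (ger0_norm (momentum_weight_ge0 t)) lerD2l normrM.
have b1 : 0 <= 1 - beta t by rewrite subr_ge0 ltW// momentum_weight_lt1.
rewrite (ger0_norm b1); set c := sclip _ _ _.
have hc : `|c| <= phi t by apply: sclip_bound; [exact: ltW (clip_level_gt0 t)|exact: smoothing_gt0].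
apply: (@le_trans _ _ (1 * phi t)); last by rewrite mul1r.
by apply: ler_pM => //; have := momentum_weight_ge0 t; lra.
Qed.

Lemma momentumS_bound_from z t i k : `|momentum z t i 0 k| <= Q ->
  `|momentum z t.+1 i 0 k| <= Q / r t ^+ 5.
Proof.
move=> h; apply: (le_trans (momentum_step z t i k)).
have r5 : 0 < r t ^+ 5 by rewrite exprn_gt0// scale_gt0.
have : beta t * `|momentum z t i 0 k| <= beta t * Q by rewrite ler_wpM2l// momentum_weight_ge0.
have -> : Q / r t ^+ 5 = beta t * Q + phi t; last by rewrite lerD2r.
have rn : r t != 0 by rewrite gt_eqF// scale_gt0.
have cn : 1 - cbeta != 0 by case/andP: cbeta01 => _ c1; rewrite subr_eq0 gt_eqF.
by rewrite /beta /phi /Q; field; rewrite rn cn.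
Qed.

Lemma momentum_bound z t i k : `|momentum z t i 0 k| <= Q.
Proof.
elim: t => [|t IH]; first by rewrite /momentum /= mxE normr0 ltW// momentum_const_gt0.
apply: (le_trans (momentumS_bound_from IH)).
rewrite ler_pdivrMr ?exprn_gt0 ?scale_gt0// ler_peMr ?scaleX_ge1//.
exact: ltW momentum_const_gt0.
Qed.

Lemma momentumS_bound z t i k : `|momentum z t.+1 i 0 k| <= Q / r t ^+ 5.
Proof. exact/momentumS_bound_from/momentum_bound. Qed.

Lemma momentum_decay z t i k : `|momentum z t i 0 k| <= 2 * Q / r t ^+ 5.
Proof.
case: t => [|t].
  rewrite /momentum /= mxE normr0 divr_ge0 ?exprn_ge0 ?(ltW (scale_gt0 _))//.
  by have := momentum_const_gt0; lra.
apply: (le_trans (momentumS_bound z t i k)).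
rewrite ler_pdivrMr ?exprn_gt0 ?scale_gt0// mulrAC ler_pdivlMr ?exprn_gt0 ?scale_gt0//.
have := @scaleSX2 R 5 t isT; have := momentum_const_gt0 => q0 h.
by have := ler_wpM2l (ltW q0) h; lra.
Qed.

(** The weight of the old momentum tends to 0, so eventually the bound has the
    order of the clipping level alone. The growth constant of
    [mean_error_growth] has to be free of 1 / (1 - cbeta), since the lower bound
    on tau does not involve cbeta. *)
Lemma momentumS_near : \forall t \near \oo, forall z i k,
  `|momentum z t.+1 i 0 k| <= 2 * cphi / r t ^+ 5.
Proof.
near=> t => z i k.
apply: (le_trans (momentum_step z t i k)).
have r5 : 0 < r t ^+ 5 by rewrite exprn_gt0// scale_gt0.
have h : 2 * Q / cphi <= r t ^+ 5 by near: t; exact: scaleX_near_ge.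
have hb : beta t <= 1 / r t ^+ 5.
  by case/andP: cbeta01 => ? /ltW ?; rewrite ler_wpM2r// invr_ge0 ltW.
have q : `|momentum z t i 0 k| <= cphi.
  apply: (le_trans (momentum_decay z t i k)).
  by rewrite ler_pdivrMr// [leRHS]mulrC -ler_pdivrMr.
have : beta t * `|momentum z t i 0 k| <= (1 / r t ^+ 5) * cphi.
  by apply: ler_pM => //; exact: momentum_weight_ge0.
rewrite /phi; lra.
Unshelve. all: by end_near. Qed.

Lemma mean_momentum_entry z t (c : R) : (forall i k, `|momentum z t i 0 k| <= c) ->
  forall k, `|mean_momentum z t 0 k| <= c.
Proof.
move=> h k; rewrite mxE summxE normrM normfV normr_nat.
rewrite ler_pdivrMl ?ltr0n//; apply: (le_trans (ler_norm_sum _ _ _)).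
apply: (@le_trans _ _ (\sum_(i < n) c)); first exact: ler_sum.
by rewrite sumr_const card_ord -[leLHS]mulr_natl.
Qed.

Lemma norm2_rV_le (v : 'rV[R]_d) (c : R) : 0 <= c -> (forall k, `|v 0 k| <= c) ->
  norm2 v <= Num.sqrt d%:R * c.
Proof.
move=> c0 h; rewrite -(@ler_pXn2r _ 2)// ?nnegrE ?norm2_ge0 ?mulr_ge0 ?sqrtr_ge0//.
rewrite exprMn (sqr_sqrtr (ler0n _ d)).
rewrite -[d in d%:R]mul1n; apply: norm2_le_entries => // i k.
by rewrite (ord1 i).
Qed.

Hypotheses (W1 : W *m const_mx 1 = const_mx 1 :> 'cV[R]_n)
  (oneW : const_mx 1 *m W = const_mx 1 :> 'rV[R]_n)
  (lam : 0 <= opnorm2 (W - averaging) < 1).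

Definition column z t k : 'cV[R]_n := \col_i iterate z t i 0 k.

Lemma columnS z t k :
  column z t.+1 k = W *m (column z t k - \col_i (eta t * momentum z t.+1 i 0 k)).
Proof.
apply/matrixP => i j; rewrite !mxE iterateS summxE.
by apply: eq_bigr => l _; rewrite !mxE.
Qed.

Lemma averaging_column z t k i j : (averaging *m column z t k) i j = mean_iterate z t 0 k.
Proof.
rewrite averagingE /mean_iterate mxE summxE; congr (_ * _).
by apply: eq_bigr => l _; rewrite mxE.
Qed.

Lemma mean_iterateS z t :
  mean_iterate z t.+1 = mean_iterate z t - eta t *: mean_momentum z t.+1.
Proof.
apply/rowP => k.
rewrite -(averaging_column z t.+1 k (Ordinal n0) 0) columnS averaging_mixing// averagingE.
rewrite /mean_iterate /mean_momentum !mxE !summxE mulrCA -mulrBr; congr (_ * _).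
rewrite mulr_sumr -sumrB; apply: eq_bigr => i _.
by rewrite !mxE.
Qed.

(** A deterministic majorant, so that the decay is uniform in the noise. *)
Fixpoint disagreement_bound (t : nat) : R :=
  if t is s.+1 then
    opnorm2 (W - averaging) * (disagreement_bound s + n%:R * ceta * Q / r s ^+ 2)
  else 0.

Lemma disagreement_le z t k :
  norm2 (column z t k - averaging *m column z t k) <= disagreement_bound t.
Proof.
have /andP[lam0 _] := lam.
elim: t => [|t IH] /=.
  rewrite (_ : _ - _ = 0); first by rewrite -(scale0r (0 : 'cV[R]_n)) norm2Z normr0 mul0r.
  apply/matrixP => i j; rewrite !mxE.
  have -> : \sum_j0 averaging i j0 * column z 0 k j0 j = (averaging *m column z 0 k) i j.
    by rewrite mxE.
  rewrite averagingE; under eq_bigr => l _ do rewrite mxE.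
  rewrite /iterate /= sumr_const card_ord -[X in _ * X]mulr_natl mulrA mulVf ?mul1r ?subrr//.
  by rewrite pnatr_eq0 -lt0n.
rewrite columnS; apply: (le_trans (mixing_contracts n0 W1 oneW _ _ lam0)).
apply: ler_wpM2l => //; apply: lerD => //.
have c0 : 0 <= ceta * Q / r t ^+ 2.
  apply: divr_ge0; last exact/exprn_ge0/ltW/scale_gt0.
  by apply: mulr_ge0; apply: ltW; [|exact: momentum_const_gt0].
rewrite -(@ler_pXn2r _ 2)// ?nnegrE ?norm2_ge0//; last by rewrite -2!mulrA mulr_ge0// mulrA.
apply: (@le_trans _ _ ((n * 1)%:R * (ceta * Q / r t ^+ 2) ^+ 2)); last first.
  rewrite muln1 -2!(mulrA n%:R) [leRHS]exprMn ler_wpM2r ?sqr_ge0//.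
  by rewrite -natrX ler_nat expnS expn1 leq_pmulr.
apply: norm2_le_entries => // i j.
rewrite mxE normrM (ger0_norm (ltW (step_size_gt0 t))) /eta mulrAC ler_wpM2r//.
  by rewrite invr_ge0 exprn_ge0// (ltW (scale_gt0 t)).
by rewrite ler_wpM2l ?momentum_bound// ltW.
Qed.

(** After multiplication by the square of the scale the recursion is still a
    contraction, eventually with ratio (1 + lambda) / 2, because consecutive
    values of the scale have ratio tending to 1. *)
Lemma disagreement_bound_decay : exists C, 0 <= C /\
  \forall t \near \oo, disagreement_bound t <= C / r t ^+ 2.
Proof.
have /andP[lam0 lam1] := lam; set l := opnorm2 _ in lam0 lam1.
pose l' := (1 + l) / 2; pose D : R := n%:R * ceta * Q.
have D0 : 0 <= D.
  by apply: mulr_ge0; [apply: mulr_ge0 => //; exact: ltW|exact: ltW momentum_const_gt0].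
have l'1 : l' < 1 by rewrite /l'; lra.
pose a t := disagreement_bound t * r t ^+ 2.
have a0 t : 0 <= a t.
  rewrite mulr_ge0 ?exprn_ge0 ?(ltW (scale_gt0 t))//.
  elim: t => //= t IH; rewrite mulr_ge0// addr_ge0// divr_ge0//.
  by rewrite exprn_ge0// (ltW (scale_gt0 t)).
have : \forall t \near \oo, a t.+1 <= l' * (a t + D).
  near=> t; rewrite /a /= -/l.
  have h := @scaleSX R 2 t isT.
  have r2 : 0 < r t ^+ 2 by rewrite exprn_gt0// scale_gt0.
  have e0 : 0 <= disagreement_bound t + D / r t ^+ 2.
    rewrite -(pmulr_lge0 _ r2) mulrDl divfK ?gt_eqF// addr_ge0//.
    exact: a0.
  apply: (@le_trans _ _ (l * (disagreement_bound t + D / r t ^+ 2) *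
     ((1 + (r t ^+ 10)^-1) * r t ^+ 2))).
    by rewrite ler_wpM2l// mulr_ge0.
  have -> : l * (disagreement_bound t + D / r t ^+ 2) * ((1 + (r t ^+ 10)^-1) * r t ^+ 2) =
     (l * (1 + (r t ^+ 10)^-1)) * (a t + D).
    by rewrite /a; field; rewrite gt_eqF// scale_gt0.
  rewrite ler_wpM2r// ?addr_ge0//.
  have h1 : (1 - l) / 2 >= (r t ^+ 10)^-1.
    rewrite invf_ple ?posrE ?exprn_gt0 ?scale_gt0//; last by lra.
    by near: t; exact: scaleX_near_ge.
  have : l * (r t ^+ 10)^-1 <= 1 * (r t ^+ 10)^-1.
    by rewrite ler_wpM2r ?invr_ge0 ?exprn_ge0 ?(ltW (scale_gt0 t))// ltW.
  rewrite /l'; lra.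
case=> N _ hN; pose C := Num.max (a N) (l' * D / (1 - l')).
exists C; split; first by rewrite le_max a0.
exists N => // t /= Nt; rewrite ler_pdivlMr ?exprn_gt0 ?scale_gt0// -/(a t).
rewrite -(subnK Nt); elim: (t - N)%N => [|k IH]; first by rewrite add0n le_max lexx.
rewrite addSn; apply: (le_trans (hN _ (leq_addl _ _))).
have : l' * a (k + N)%N <= l' * C by rewrite ler_wpM2l// /l'; lra.
have : l' * D <= C * (1 - l').
  by rewrite -ler_pdivrMr ?subr_gt0// le_max lexx orbT.
lra.
Unshelve. all: by end_near. Qed.

Lemma consensus_near : exists C, 0 <= C /\ \forall t \near \oo, forall z i k,
  `|iterate z t i 0 k - mean_iterate z t 0 k| <= C / r t ^+ 2.
Proof.
have [C [C0 hC]] := disagreement_bound_decay; exists C; split=> //.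
near=> t => z i k.
apply: (le_trans _ (near hC t _)) => //.
apply: (le_trans _ (disagreement_le z t k)).
have -> : iterate z t i 0 k - mean_iterate z t 0 k =
    (column z t k - averaging *m column z t k) i 0.
  by rewrite [RHS]mxE [X in _ = _ + X]mxE averaging_column [X in _ = X + _]mxE.
exact: entry_le_norm2.
Unshelve. all: by end_near. Qed.

Lemma mean_error_step z t c : 0 <= c -> (forall i k, `|momentum z t.+1 i 0 k| <= c) ->
  norm2 (mean_iterate z t.+1 - xs) <=
    norm2 (mean_iterate z t - xs) + eta t * (Num.sqrt d%:R * c).
Proof.
move=> c0 h; rewrite mean_iterateS addrAC; apply: (le_trans (norm2D_rV _ _)).
rewrite lerD2l norm2N norm2Z (ger0_norm (ltW (step_size_gt0 t))) ler_wpM2l ?(ltW (step_size_gt0 t))//.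
by apply: norm2_rV_le => //; exact: mean_momentum_entry.
Qed.

Lemma mean_iterate0 z : mean_iterate z 0 = x0.
Proof.
rewrite /mean_iterate /iterate /= sumr_const card_ord -[x0 *+ n]scaler_nat scalerA mulVf ?scale1r//.
by rewrite pnatr_eq0 -lt0n.
Qed.

Lemma mean_error_bounded t : exists B, forall z, norm2 (mean_iterate z t - xs) <= B.
Proof.
elim: t => [|t [B hB]].
  by exists (norm2 (x0 - xs)) => z; rewrite mean_iterate0.
exists (B + eta t * (Num.sqrt d%:R * Q)) => z.
apply: (le_trans (mean_error_step (ltW momentum_const_gt0) _)).
  by move=> i k; exact: momentum_bound.
by rewrite lerD2r.
Qed.

(** The steps have size at most 2 sqrt(d) ceta cphi t^(-7/10), so they sum up to
    O(t^(3/10)), the order of the square root of the smoothing. This is what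
    keeps the gradients in the nearly linear range of the clipping. *)
Lemma mean_error_growth : (0 < d)%N -> \forall t \near \oo, forall z,
  norm2 (mean_iterate z t - xs) <= 17 * Num.sqrt d%:R * ceta * cphi * r t ^+ 3.
Proof.
move=> d0; have [N _ hN] := momentumS_near.
have [B hB] := mean_error_bounded N.
pose g := Num.sqrt d%:R * ceta * cphi.
have g0 : 0 < g by rewrite !mulr_gt0// sqrtr_gt0 ltr0n.
have h t z : (N <= t)%N -> norm2 (mean_iterate z t - xs) <= B + 16 * g * r t ^+ 3.
  move=> Nt; rewrite -(subnK Nt); elim: (t - N)%N => [|k IH].
    rewrite add0n (le_trans (hB z))// lerDl; apply: mulr_ge0; first by rewrite mulr_ge0// ltW.
    exact/exprn_ge0/ltW/scale_gt0.
  rewrite addSn; set s := (k + N)%N in IH *.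
  have r7 : 0 < r s ^+ 7 by rewrite exprn_gt0// scale_gt0.
  apply: (le_trans (mean_error_step _ (hN s (leq_addl _ _) z))).
    by apply: divr_ge0; [by rewrite mulr_ge0 ?(ltW cphi0)|exact/exprn_ge0/ltW/scale_gt0].
  have -> : eta s * (Num.sqrt d%:R * (2 * cphi / r s ^+ 5)) = 16 * g * (8 * r s ^+ 7)^-1.
    by rewrite /eta /g; field; rewrite gt_eqF// scale_gt0.
  have : 16 * g * (8 * r s ^+ 7)^-1 <= 16 * g * (r s.+1 ^+ 3 - r s ^+ 3).
    by rewrite ler_wpM2l ?scale3_increment// mulr_ge0// ltW.
  lra.
near=> t => z; apply: (le_trans (h t z _)).
  by near: t; exists N.
have : B <= g * r t ^+ 3.
  by rewrite mulrC -ler_pdivrMr//; near: t; exact: scaleX_near_ge.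
rewrite /g; lra.
Unshelve. all: by end_near. Qed.
End Dynamics.

(** * Drift of the averaged clipping towards the minimizer *)

Section Drift.
Context {R : realType} {n d : nat}.
Variables (mu L : R) (f : 'I_n -> 'rV[R]_d -> R) (xs : 'rV[R]_d).
Hypotheses (n0 : (0 < n)%N) (Hf : function_assumption mu L f)
  (Hxs : is_argmin (average f) xs).

Lemma ler_mul_norm (u v c : R) : `|v| <= c -> - (`|u| * c) <= u * v.
Proof.
move=> h; have : `|u * v| <= `|u| * c by rewrite normrM ler_wpM2l.
by rewrite ler_norml => /andP[].
Qed.

(** With g and gs the gradients at x and at xs, each psi (a) is split into
    psi (a) - psi (g), small by the Lipschitz bound; psi (g) - psi (gs), a
    diagonal multiple K (1 - E) (g - gs) with |E| <= rho, to which
    [grad_perturbed_monotone] applies; and psi (gs) - K gs, small by assumption.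
    The remaining terms K gs cancel in the sum over the nodes, although none of
    them is small. *)
Lemma drift_lower_bound (K rho e1 e3 : R) (psi : 'I_n -> 'I_d -> R -> R)
    (x : 'rV[R]_d) (a : 'I_n -> 'rV[R]_d) :
  0 < K -> 0 <= rho -> L * rho ^+ 2 <= mu / 2 -> 0 <= e1 -> 0 <= e3 -> 
  (forall i k u v, `|psi i k u - psi i k v| <= K * `|u - v|) ->
  (forall i k, `|psi i k (grad (f i) x 0 k) - psi i k (grad (f i) xs 0 k)
     - K * (grad (f i) x 0 k - grad (f i) xs 0 k)|
     <= K * rho * `|grad (f i) x 0 k - grad (f i) xs 0 k|) ->
  (forall i k, `|psi i k (grad (f i) xs 0 k) - K * grad (f i) xs 0 k| <= K * e3) ->
  (forall i k, `|a i 0 k - grad (f i) x 0 k| <= e1) ->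
  K * (mu / 4 * norm2 (x - xs) ^+ 2 - d%:R * (e1 + e3) * norm2 (x - xs)) <=
    n%:R^-1 * \sum_i \sum_k (x - xs) 0 k * psi i k (a i 0 k).
Proof.
move=> K0 rho0 Lrho e10 e30 lip lin star pert.
have [mu0 muL Hfi] := Hf; set y := x - xs.
set N := norm2 y.
rewrite ler_pdivlMl ?ltr0n//.
have hstat : \sum_i dot y (grad (f i) xs) = 0.
  have := @sum_grad_argmin R d n f xs n0 (fun i => let: And3 h _ _ := (Hfi i).1 in h) Hxs.
  by rewrite -dot_sumr => ->; apply: big1 => k _; rewrite [(0 : 'rV_d) 0 k]mxE mulr0.
suff main i : K * (mu / 4 * N ^+ 2 - d%:R * (e1 + e3) * N) + K * dot y (grad (f i) xs)
    <= \sum_k y 0 k * psi i k (a i 0 k).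
  have := ler_sum (index_enum 'I_n) (fun i (_ : xpredT i) => main i).
  rewrite big_split /= sumr_const card_ord -mulr_sumr hstat mulr0 addr0.
  by rewrite -[_ *+ n]mulr_natl.
have [[df1 df2 _] hH] := Hfi i.
pose g := grad (f i) x; pose gs := grad (f i) xs; pose D := g - gs.
(* the factor 1 - E of coordinate k; it is transferred from the increment D of
   the gradient to the displacement y, which becomes y - e *)
pose slope k := (psi i k (g 0 k) - psi i k (gs 0 k)) / (K * D 0 k).
pose e : 'rV[R]_d := \row_k (if D 0 k == 0 then 0 else y 0 k * (1 - slope k)).
have De k : D 0 k = g 0 k - gs 0 k by rewrite mxE [X in _ + X]mxE.
have ye k : (y - e) 0 k = y 0 k - e 0 k by rewrite mxE [X in _ + X]mxE.
have ee k : e 0 k = if D 0 k == 0 then 0 else y 0 k * (1 - slope k) by rewrite mxE.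
have psiD k : y 0 k * (psi i k (g 0 k) - psi i k (gs 0 k)) = K * ((y - e) 0 k * D 0 k).
  rewrite ye ee; case: eqVneq => [D0|D0].
    have : g 0 k = gs 0 k by apply/eqP; rewrite -subr_eq0 -De D0.
    by move=> ->; rewrite D0 subrr !mulr0.
  by rewrite /slope; field; rewrite D0 gt_eqF.
have he k : `|e 0 k| <= rho * `|y 0 k|.
  have hl := lin i k; rewrite -/g -/gs -De in hl.
  rewrite ee; case: eqVneq => [D0|D0]; first by rewrite normr0 mulr_ge0.
  rewrite normrM mulrC ler_wpM2r//.
  have KD : 0 < K * `|D 0 k| by rewrite mulr_gt0// normr_gt0.
  rewrite -(ler_pM2r KD).
  have -> : rho * (K * `|D 0 k|) = K * rho * `|D 0 k| by ring.
  apply: le_trans hl; rewrite -{1}(gtr0_norm K0) -!normrM distrC.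
  rewrite /slope (_ : (1 - _) * _ = K * D 0 k - (psi i k (g 0 k) - psi i k (gs 0 k)))//.
  by field; rewrite D0 gt_eqF.
have hmono := grad_perturbed_monotone mu0 muL df2 hH xs he.
have xy : xs + y = x by rewrite /y addrC subrK.
rewrite xy -/g -/gs -/D in hmono.
have hsum : \sum_k (K * ((y - e) 0 k * D 0 k) + (K * (y 0 k * gs 0 k) - K * (e1 + e3) * N)) <=
    \sum_k y 0 k * psi i k (a i 0 k).
  apply: ler_sum => k _.
  have -> : y 0 k * psi i k (a i 0 k) = y 0 k * (psi i k (g 0 k) - psi i k (gs 0 k)) +
     (y 0 k * (psi i k (a i 0 k) - psi i k (g 0 k)) + (K * (y 0 k * gs 0 k) +
      y 0 k * (psi i k (gs 0 k) - K * gs 0 k))) by ring.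
  rewrite psiD lerD2l.
  have hy : `|y 0 k| <= N := entry_le_norm2 y 0 k.
  have h1 : `|psi i k (a i 0 k) - psi i k (g 0 k)| <= K * e1.
    by apply: (le_trans (lip _ _ _ _)); rewrite ler_pM2l.
  have := ler_mul_norm (y 0 k) h1; have := ler_mul_norm (y 0 k) (star i k).
  have : `|y 0 k| * (K * e1) <= N * (K * e1) by rewrite ler_wpM2r// mulr_ge0// ltW.
  have : `|y 0 k| * (K * e3) <= N * (K * e3) by rewrite ler_wpM2r// mulr_ge0// ltW.
  rewrite -/gs; lra.
apply: le_trans hsum.
rewrite !big_split /= -!mulr_sumr -/(dot (y - e) D) -/(dot y gs).
rewrite sumr_const card_ord -[_ *+ d]mulr_natl.
have : K * ((mu - L * rho ^+ 2) / 2 * dot y y) <= K * dot (y - e) D by rewrite ler_pM2l.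
have : K * ((mu / 4) * dot y y) <= K * ((mu - L * rho ^+ 2) / 2 * dot y y).
  by rewrite ler_pM2l// ler_wpM2r ?dotvv_ge0//; lra.
rewrite -norm2_sqr -/N /gs; lra.
Qed.
End Drift.

(** * Measurability of the iterates *)

Section IterateMeasurability.
Context {R : realType} {n d : nat}.
Variables (f : 'I_n -> 'rV[R]_d -> R) (W : 'M[R]_n) (cphi tau ceta cbeta : R)
  (x0 : 'rV[R]_d).
Hypotheses (df : forall i x, differentiable (grad (f i)) x) (tau0 : 0 < tau).
Context {dT : measure_display} {T : measurableType dT}.
Variables (xi : nat -> 'I_n -> 'I_d -> T -> R) (t : nat).
Hypothesis mxi : forall s i k, (s < t)%N -> measurable_fun setT (xi s i k).

Local Notation noise w := (fun s i => \row_k xi s i k w).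
Local Notation x := (fun w s i => iterate f W cphi tau ceta cbeta x0 (noise w) s i).
Local Notation m := (fun w s i => momentum f W cphi tau ceta cbeta x0 (noise w) s i).

Lemma continuous_grad_coord i k : continuous (fun y => grad (f i) y 0 k).
Proof.
move=> y; apply: (@continuous_comp _ _ _ (grad (f i)) (fun v : 'rV[R]_d => v 0 k)).
  exact: differentiable_continuous.
exact: coord_continuous.
Qed.

(** The state at step s is a continuous function of the noise of the steps before
    s. The sigma-algebra on T is arbitrary: it is used both for the ambient one
    and for the one generated by the past. *)
Lemma measurable_iterate_momentum s : (s <= t)%N ->
  (forall i k, measurable_fun setT (fun w => x w s i 0 k)) /\
  (forall i k, measurable_fun setT (fun w => m w s i 0 k)).
Proof.
elim: s => [|s IH] st; first by split=> i k; exact: measurable_cst.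
have [IHx IHm] := IH (ltnW st).
have mm i k : measurable_fun setT (fun w => m w s.+1 i 0 k).
  under eq_fun do rewrite momentumS_coord residual_coord [X in sclip _ _ (_ + X)]mxE.
  apply: measurable_funD; first by apply: measurable_funM => //; exact: measurable_cst.
  apply: measurable_funM; first exact: measurable_cst.
  apply: measurableT_comp.
    apply: continuous_measurable_fun; apply: continuous_sclip; exact: smoothing_gt0.
  apply: measurable_funD; last exact: mxi.
  apply: measurable_funB => //.
  pose g (y : 'rV[R]_d) : R := grad (f i) y 0 k.
  have cg : continuous g by exact: continuous_grad_coord.
  have := @measurable_fun_continuous_rV R dT T d g (fun w => x w s i).
  by move=> /(_ cg (IHx i)).
split=> // i k.
under eq_fun do rewrite iterateS summxE.
apply: measurable_sum => j.
under eq_fun do rewrite mxE [X in _ * X]mxE [X in _ * (_ + X)]mxE [X in _ * (_ - X)]mxE.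
apply: measurable_funM; first exact: measurable_cst.
apply: measurable_funB => //.
by apply: measurable_funM => //; exact: measurable_cst.
Qed.

End IterateMeasurability.

(** * Averaging out the current noise *)

Section Decoupling.
Context {R : realType} {n d : nat} {dT : measure_display} {T : measurableType dT}.
Variables (P : probability T R) (xi : nat -> 'I_n -> 'I_d -> {RV P >-> R}).

Definition step_sigma_algebra (t : nat) : set_system T :=
  generated_sigma_algebra (fun ik : 'I_n * 'I_d => (xi t ik.1 ik.2 : T -> R)).
Local Notation G := step_sigma_algebra.

Lemma step_sigma_algebraP t : sigma_algebra setT (G t).
Proof. exact: smallest_sigma_algebra. Qed.

Lemma step_sigma_algebra_measurable t : G t `<=` measurable.
Proof.
apply: smallest_sub; first exact: sigma_algebra_measurable.
move=> A [ik _ [B mB <-]].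
by apply: measurable_funP => //.
Qed.

Lemma step_sigma_algebra_setI t : setI_closed (G t).
Proof.
move=> A B GA GB.
pose S := g_sigma_algebraType (\bigcup_(ik : 'I_n * 'I_d)
  preimage_set_system setT (xi t ik.1 ik.2 : T -> R) measurable).
exact: (@measurableI _ S A B GA GB).
Qed.

Lemma step_sigma_algebra_setT t : G t setT.
Proof.
have [h0 hC _] := step_sigma_algebraP t.
by have := hC _ h0; rewrite setD0.
Qed.

Lemma step_preimage t i k (B : set R) : measurable B -> G t (xi t i k @^-1` B).
Proof.
move=> mB; apply: sub_sigma_algebra; exists (i, k) => //; exists B => //.
by rewrite setTI.
Qed.

Definition pastType t := g_sigma_algebraType (past G t).

Lemma measurable_past s t i k : (s < t)%N ->
  measurable_fun (setT : set (pastType t)) (xi s i k : T -> R).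
Proof.
move=> st _ B mB; rewrite setTI; apply: sub_sigma_algebra.
exists (fun j => if j == s then xi s i k @^-1` B else setT); split.
  move=> j _; case: eqP => [->|_]; first exact: step_preimage.
  exact: step_sigma_algebra_setT.
apply/seteqP; split => w /=.
  by move=> h j _; case: eqP.
by move=> /(_ s); rewrite eqxx /= mem_iota add0n st; exact.
Qed.

Hypothesis ind : mutually_independent P G.

(** Factors that depend on the past only may be frozen while the noise of step t
    is averaged, because the two are independent. *)
Lemma sclip_decoupling t i k (phi eps M : R) (u a : T -> R) :
  0 <= phi -> 0 < eps -> (forall w, `|u w| <= M) ->
  measurable_fun setT u -> measurable_fun setT a ->
  measurable_fun (setT : set (pastType t)) u ->
  measurable_fun (setT : set (pastType t)) a ->
  \int[P]_w (u w * sclip phi eps (a w + xi t i k w)) =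
  \int[P]_w (u w * smoothed_clip (xi t i k) phi eps (a w)).
Proof.
move=> phi0 eps0 uM mu ma mu' ma'.
pose X w := (u w, a w).
have mX : measurable_fun setT X by exact: measurable_fun_pair.
have mX' : measurable_fun (setT : set (pastType t)) X by exact: measurable_fun_pair.
have mV : measurable_fun setT (xi t i k : T -> R) by exact: measurable_funPT.
pose F (q : R * R * R) := q.1.1 * sclip phi eps (q.1.2 + q.2).
have msclip : measurable_fun setT (sclip phi eps).
  by apply: continuous_measurable_fun; exact: continuous_sclip.
have mF : measurable_fun setT F.
  apply: measurable_funM; first exact: measurableT_comp.
  apply: measurableT_comp => //; apply: measurable_funD => //.
  exact: measurableT_comp.
have := @expectation_independent R dT T P _ _ _ _ X (xi t i k) F (M * phi) mX mV.
rewrite /F /= => -> //.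
- apply: eq_Rintegral => w _; rewrite /smoothed_clip RintegralZl//.
  apply: bounded_measurable_integrable; apply: bounded_measurable_sclip => //.
  by apply: measurable_funD => //; exact: measurable_cst.
- move=> A B mA mB.
  apply: (independent_past ind step_sigma_algebra_measurable
    step_sigma_algebra_setI step_sigma_algebra_setT (t := t)).
  + by have := mX' measurableT A mA; rewrite setTI.
  + exact: step_preimage.
- move=> w w'; rewrite normrM ler_pM//; exact: sclip_bound.
Qed.
End Decoupling.

(** * Consequences of the parameter window *)

Section Constants.
Context {R : realType}.

(** The squared gradients are at most of order d kappa^2 sigma^2 t^(3/5), by the
    upper bound on ceta cphi, and the smoothing is at least of order
    d sigma^2 kappa^(5/2) t^(3/5). Their quotient is of order 1 / sqrt(kappa), the
    accuracy required by [grad_perturbed_monotone]: this dictates the exponent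
    5/2. The second inequality is the resulting contraction rate. *)
Lemma parameter_window (mu L sigma ceta cphi tau : R) (d : nat) :
  0 < mu -> mu <= L -> 0 < sigma -> (0 < d)%N -> 0 < cphi -> 0 < tau -> 0 < ceta ->
  1 / 100 * (sigma ^+ 2 / mu ^+ 2) <= ceta ^+ 2 * cphi ^+ 2 <= 1 / 25 * (sigma ^+ 2 / mu ^+ 2) ->
  200 * d%:R * sigma ^+ 2 * (L / mu) `^ (5 / 2) <= tau
    <= 400 * d%:R * sigma ^+ 2 * (L / mu) `^ (5 / 2) ->
  972 * (L * (Num.sqrt d%:R * ceta * cphi)) ^+ 2 / tau <= 1 / 5 / Num.sqrt (L / mu) /\
  1 / 800 * d%:R `^ (- (1 / 2)) * (L / mu) `^ (- (5 / 4)) <=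
     ceta * cphi / Num.sqrt tau * (mu / 4).
Proof.
move=> mu0 muL s0 d0 cphi0 tau0 ceta0 /andP[lo hi] /andP[tlo thi].
have d0' : 0 < d%:R :> R by rewrite ltr0n.
set kap := L / mu in tlo thi *; have k0 : 0 < kap by rewrite divr_gt0// (lt_le_trans mu0).
pose s := Num.sqrt kap; have sk0 : 0 < s by rewrite sqrtr_gt0.
have sk2 : s ^+ 2 = kap by rewrite sqr_sqrtr// ltW.
have pE : kap `^ (5 / 2) = kap ^+ 2 * s.
  rewrite /s -powR12_sqrt ?(ltW k0)// -powR_mulrn ?(ltW k0)// -powRD.
    by congr (_ `^ _); field.
  by rewrite (gt_eqF k0) implybT.
rewrite pE in tlo thi.
have L0 : 0 < L by rewrite (lt_le_trans mu0).
have kapmu : kap * mu = L by rewrite /kap divfK// gt_eqF.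
split.
  rewrite ler_pdivrMr// -/s.
  have -> : 972 * (L * (Num.sqrt d%:R * ceta * cphi)) ^+ 2 =
     972 * L ^+ 2 * d%:R * (ceta ^+ 2 * cphi ^+ 2).
    by rewrite !exprMn sqr_sqrtr ?ler0n//; ring.
  apply: (@le_trans _ _ (972 * L ^+ 2 * d%:R * (1 / 25 * (sigma ^+ 2 / mu ^+ 2)))).
    apply: ler_wpM2l hi; apply: mulr_ge0; last exact: ler0n.
    by apply: mulr_ge0; [exact: ler0n|exact: sqr_ge0].
  have -> : 972 * L ^+ 2 * d%:R * (1 / 25 * (sigma ^+ 2 / mu ^+ 2)) =
     972 / 25 * d%:R * sigma ^+ 2 * kap ^+ 2 by rewrite -kapmu; field; rewrite gt_eqF.
  have h : 1 / 5 / s * (200 * d%:R * sigma ^+ 2 * (kap ^+ 2 * s)) <= 1 / 5 / s * tau.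
    by apply: ler_wpM2l tlo; apply: divr_ge0; [lra|exact: ltW].
  apply: le_trans h.
  have -> : 1 / 5 / s * (200 * d%:R * sigma ^+ 2 * (kap ^+ 2 * s)) =
     40 * d%:R * sigma ^+ 2 * kap ^+ 2 by field; rewrite gt_eqF.
  have : 0 <= d%:R * sigma ^+ 2 * kap ^+ 2.
    by apply: mulr_ge0; [apply: mulr_ge0; [exact: ler0n|]|]; exact: sqr_ge0.
  lra.
pose P := kap ^+ 2 * s; have P0 : 0 < P by rewrite mulr_gt0// exprn_gt0.
have h1 : sigma / mu / 10 <= ceta * cphi.
  rewrite -(@ler_pXn2r _ 2)//; last 2 first.
  - by rewrite nnegrE; apply/ltW/divr_gt0 => //; exact: divr_gt0.
  - by rewrite nnegrE; apply/ltW/mulr_gt0.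
  rewrite (_ : (sigma / mu / 10) ^+ 2 = 1 / 100 * (sigma ^+ 2 / mu ^+ 2)); first by rewrite exprMn.
  by field; rewrite gt_eqF.
have h2 : Num.sqrt tau <= 20 * sigma * Num.sqrt d%:R * Num.sqrt P.
  have c0 : 0 <= 20 * sigma * Num.sqrt d%:R * Num.sqrt P.
    by rewrite -!mulrA; apply: mulr_ge0 => //; apply: mulr_ge0; [exact: ltW|apply: mulr_ge0; exact: sqrtr_ge0].
  rewrite -(@ler_pXn2r _ 2)//; last by rewrite nnegrE sqrtr_ge0.
  rewrite (sqr_sqrtr (ltW tau0)).
  have -> : (20 * sigma * Num.sqrt d%:R * Num.sqrt P) ^+ 2 =
    400 * (Num.sqrt d%:R ^+ 2) * sigma ^+ 2 * (Num.sqrt P ^+ 2) by ring.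
  by rewrite (sqr_sqrtr (ler0n _ _)) (sqr_sqrtr (ltW P0)).
have -> : d%:R `^ (- (1 / 2)) = (Num.sqrt d%:R)^-1 :> R.
  by rewrite powRN mul1r powR12_sqrt ?ler0n.
have -> : kap `^ (- (5 / 4)) = (Num.sqrt P)^-1.
  rewrite powRN /P -pE -powR12_sqrt ?powR_ge0// -powRrM; congr (_ `^ _)^-1.
  by field.
have st0 : 0 < Num.sqrt tau by rewrite sqrtr_gt0.
have sd0 : 0 < Num.sqrt d%:R :> R by rewrite sqrtr_gt0.
have sP0 : 0 < Num.sqrt P by rewrite sqrtr_gt0.
apply: (@le_trans _ _ (sigma / mu / 10 / (20 * sigma * Num.sqrt d%:R * Num.sqrt P) * (mu / 4))).
  rewrite le_eqVlt; apply/orP; left; apply/eqP; field.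
  by rewrite !gt_eqF.
rewrite ler_wpM2r ?divr_ge0 ?(ltW mu0)//.
apply: ler_pM => //.
- by apply/ltW/divr_gt0 => //; exact: divr_gt0.
- by rewrite invr_ge0 -!mulrA; apply: mulr_ge0 => //; apply: mulr_ge0; [exact: ltW|apply: mulr_ge0; exact: sqrtr_ge0].
- rewrite lef_pV2// ?posrE// -!mulrA; apply: mulr_gt0 => //.
  by apply: mulr_gt0 => //; apply: mulr_gt0.
Qed.
End Constants.

(** * Drift at late times *)

Section LipschitzCoordinates.
Context {R : realType} {d : nat}.
Variables (mu L : R) (f : 'rV[R]_d -> R).
Hypotheses (mu0 : 0 < mu) (muL : mu <= L).
Hypothesis df : forall x, differentiable (grad f) x.
Hypothesis Hf : forall x, loewner_le mu%:M (hess f x) /\ loewner_le (hess f x) L%:M.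

Lemma dot_delta (k : 'I_d) (v : 'rV[R]_d) : dot (delta_mx 0 k) v = v 0 k.
Proof.
rewrite /dot (bigD1 k)//= big1 => [|j jk]; last by rewrite mxE (negbTE jk) mul0r.
by rewrite mxE !eqxx mul1r addr0.
Qed.

Lemma grad_coord_lipschitz (x y : 'rV[R]_d) k :
  `|grad f x 0 k - grad f y 0 k| <= L * norm2 (x - y).
Proof.
have L0 : 0 <= L by exact: le_trans (ltW mu0) muL.
have := grad_lipschitz mu0 muL df Hf (delta_mx 0 k) y (x - y).
have De : (grad f x - grad f y) 0 k = grad f x 0 k - grad f y 0 k.
  by rewrite mxE [X in _ + X]mxE.
rewrite (addrC y) subrK !dot_delta [delta_mx 0 k 0 k]mxE !eqxx mulr1 De -norm2_sqr -exprMn => h.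
by rewrite -(@ler_pXn2r _ 2) ?nnegrE ?mulr_ge0 ?norm2_ge0// real_normK ?num_real.
Qed.
End LipschitzCoordinates.

Section DriftNear.
Context {R : realType} {n d : nat} {dT : measure_display} {T : measurableType dT}.
Variables (mu L cstar sigma : R) (f : 'I_n -> 'rV[R]_d -> R) (xs : 'rV[R]_d)
  (P : probability T R) (xi : nat -> 'I_n -> 'I_d -> {RV P >-> R})
  (W : 'M[R]_n) (cphi tau ceta cbeta : R) (x0 : 'rV[R]_d).
Hypotheses (n0 : (0 < n)%N) (d0 : (0 < d)%N) (Hf : function_assumption mu L f)
  (Hxs : is_argmin (average f) xs) (Hcs : heterogeneity_assumption cstar f xs)
  (W1 : W *m const_mx 1 = const_mx 1 :> 'cV[R]_n)
  (oneW : const_mx 1 *m W = const_mx 1 :> 'rV[R]_n)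
  (lam : 0 <= opnorm2 (W - averaging) < 1)
  (cphi0 : 0 < cphi) (tau0 : 0 < tau) (ceta0 : 0 < ceta) (cbeta01 : 0 <= cbeta < 1)
  (sigma0 : 0 < sigma).
Hypothesis xi_abs : forall t i k, P.-integrable setT (fun w => `|xi t i k w|%:E) /\
  \int[P]_w `|xi t i k w| <= sigma.
Hypothesis xi_odd : forall t i k (h : R -> R) (M : R), measurable_fun setT h ->
  (forall u, `|h u| <= M) -> (forall u, h (- u) = - h u) -> \int[P]_w h (xi t i k w) = 0.
Hypothesis window :
  972 * (L * (Num.sqrt d%:R * ceta * cphi)) ^+ 2 / tau <= 1 / 5 / Num.sqrt (L / mu).

Local Notation r := (@scale R).
Local Notation phi := (clip_level cphi).
Local Notation eps := (smoothing tau).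
Local Notation X := (iterate f W cphi tau ceta cbeta x0).
Local Notation m := (momentum f W cphi tau ceta cbeta x0).
Local Notation resid := (residual f W cphi tau ceta cbeta x0).
Local Notation xbar := (mean_iterate f W cphi tau ceta cbeta x0).
Local Notation Q := (momentum_const cphi cbeta).

(** Slope of the clipping at 0. *)
Definition gain (t : nat) : R := phi t / Num.sqrt (eps t).
Definition mean_clip t i k : R -> R := smoothed_clip (xi t i k) (phi t) (eps t).

Local Notation psi := mean_clip.

Lemma sqrt_smoothing t : Num.sqrt (eps t) = Num.sqrt tau * r t ^+ 3.
Proof.
rewrite /smoothing sqrtrM ?(ltW tau0)//; congr (_ * _).
by rewrite (_ : r t ^+ 6 = (r t ^+ 3) ^+ 2) ?sqrtr_sqr ?ger0_norm ?exprn_ge0 ?(ltW (scale_gt0 t))// -exprM.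
Qed.

Lemma gain_gt0 t : 0 < gain t.
Proof. by rewrite divr_gt0 ?clip_level_gt0// sqrtr_gt0 smoothing_gt0. Qed.

Lemma eta_gain t : step_size ceta t * gain t = ceta * cphi / Num.sqrt tau / r t ^+ 10.
Proof.
have r0 : r t != 0 by rewrite gt_eqF// scale_gt0.
have st0 : Num.sqrt tau != 0 by rewrite gt_eqF// sqrtr_gt0.
by rewrite /step_size /gain /clip_level sqrt_smoothing; field; rewrite r0 st0.
Qed.

Lemma cstar_ge0 : 0 <= cstar.
Proof. exact: le_trans (normr_ge0 _) (Hcs (Ordinal n0)). Qed.

Lemma grad_star_coord i k : `|grad (f i) xs 0 k| <= cstar.
Proof.
apply: le_trans (Hcs i).
rewrite [leRHS]/Num.norm /= mx_normrE.
exact: (le_bigmax _ (fun ij : 'I_1 * 'I_d => `|grad (f i) xs ij.1 ij.2|) (0, k)).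
Qed.

(** The gradient at xs contributes at most one unit of t^(3/10) next to the 17 of
    [mean_error_growth], and 972 = 3 * 18^2; the noise term is negligible. *)
Lemma mean_clip_error_near : \forall t \near \oo,
  3 * (cstar + L * (17 * Num.sqrt d%:R * ceta * cphi * r t ^+ 3)) ^+ 2 / eps t +
    2 * sigma / Num.sqrt (eps t) <= 1 / 4 / Num.sqrt (L / mu).
Proof.
have [mu0 muL _] := Hf; have L0 : 0 < L by exact: lt_le_trans muL.
pose g := L * (Num.sqrt d%:R * ceta * cphi).
have g0 : 0 < g by rewrite !mulr_gt0// sqrtr_gt0 ltr0n.
have sk0 : 0 < Num.sqrt (L / mu) by rewrite sqrtr_gt0 divr_gt0.
have st0 : 0 < Num.sqrt tau by rewrite sqrtr_gt0.
near=> t.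
have r30 : 0 < r t ^+ 3 by rewrite exprn_gt0// scale_gt0.
have h1 : cstar / g <= r t ^+ 3 by near: t; exact: scaleX_near_ge.
have h2 : 40 * sigma * Num.sqrt (L / mu) / Num.sqrt tau <= r t ^+ 3.
  by near: t; exact: scaleX_near_ge.
rewrite ler_pdivrMr// in h1.
have A : 3 * (cstar + L * (17 * Num.sqrt d%:R * ceta * cphi * r t ^+ 3)) ^+ 2 / eps t
    <= 1 / 5 / Num.sqrt (L / mu).
  apply: le_trans window; rewrite -/g.
  have -> : L * (17 * Num.sqrt d%:R * ceta * cphi * r t ^+ 3) = 17 * (r t ^+ 3 * g).
    by rewrite /g; ring.
  have -> : 972 * g ^+ 2 / tau = 3 * (18 * (r t ^+ 3 * g)) ^+ 2 / eps t.
    rewrite /smoothing; field.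
    by rewrite (gt_eqF tau0) gt_eqF// scale_gt0.
  rewrite ler_wpM2r ?invr_ge0 ?(ltW (smoothing_gt0 tau0 t))// ler_wpM2l//.
  have rg : 0 <= r t ^+ 3 * g by rewrite mulr_ge0// ltW.
  by have c0 := cstar_ge0; rewrite lerXn2r ?nnegrE//; lra.
have B : 2 * sigma / Num.sqrt (eps t) <= 1 / 20 / Num.sqrt (L / mu).
  rewrite sqrt_smoothing (ler_pdivrMr _ _ (mulr_gt0 st0 r30)).
  have -> : 2 * sigma = 1 / 20 / Num.sqrt (L / mu) *
      (Num.sqrt tau * (40 * sigma * Num.sqrt (L / mu) / Num.sqrt tau)).
    by field; rewrite !gt_eqF.
  by rewrite ler_wpM2l ?divr_ge0 ?(ltW sk0)// ler_wpM2l// ltW.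
apply: (le_trans (lerD A B)); lra.
Unshelve. all: by end_near. Qed.

(** Disagreement and momentum perturb the argument of the clipping by
    O(t^(-1/5)), and the nonlinearity at xs, where the gradients are bounded by
    cstar, contributes O(t^(-3/10)); the rest is [drift_lower_bound]. *)
Lemma drift_near : exists C, 0 <= C /\ \forall t \near \oo, forall z,
  gain t * (mu / 4 * norm2 (xbar z t - xs) ^+ 2 - C / r t ^+ 2 * norm2 (xbar z t - xs)) <=
    n%:R^-1 * \sum_i \sum_k (xbar z t - xs) 0 k * psi t i k (resid z t i 0 k).
Proof.
have [mu0 muL Hfi] := Hf; have L0 : 0 < L by exact: lt_le_trans muL.
have sk0 : 0 < Num.sqrt (L / mu) by rewrite sqrtr_gt0 divr_gt0.
have st0 : 0 < Num.sqrt tau by rewrite sqrtr_gt0.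
have c0 := cstar_ge0.
have [C1 [C10 hC1]] := @consensus_near R n d f W cphi tau ceta cbeta x0 n0 cphi0 tau0 ceta0 cbeta01 W1 oneW lam.
pose E1 := L * (Num.sqrt d%:R * C1) + 2 * Q.
pose E3 := 3 * cstar ^+ 3 / tau + 2 * sigma * cstar / Num.sqrt tau.
have Q0 := momentum_const_gt0 cphi0 cbeta01.
have E10 : 0 <= E1.
  by rewrite /E1; nonneg.
have E30 : 0 <= E3.
  by rewrite /E3; nonneg.
exists (d%:R * (E1 + E3)); split; first by nonneg.
near=> t.
have growth : forall z, norm2 (xbar z t - xs) <= 17 * Num.sqrt d%:R * ceta * cphi * r t ^+ 3.
  by near: t; exact: mean_error_growth.
have cons : forall z i k, `|X z t i 0 k - xbar z t 0 k| <= C1 / r t ^+ 2 by near: t.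
move=> z; have r0 := scale_gt0 (R := R) t.
have rX0 (k : nat) : 0 < r t ^+ k by rewrite exprn_gt0.
pose M := cstar + L * (17 * Num.sqrt d%:R * ceta * cphi * r t ^+ 3).
pose rho := 3 * M ^+ 2 / eps t + 2 * sigma / Num.sqrt (eps t).
have K0 := gain_gt0 t; have e0 := smoothing_gt0 tau0 t; have p0 := clip_level_gt0 cphi0 t.
have rho0 : 0 <= rho.
  by rewrite /rho; nonneg.
have rhoS : rho <= 1 / 4 / Num.sqrt (L / mu) by rewrite /rho /M; near: t; exact: mean_clip_error_near.
have Lrho : L * rho ^+ 2 <= mu / 2.
  have : rho ^+ 2 <= (1 / 4 / Num.sqrt (L / mu)) ^+ 2.
    by rewrite lerXn2r ?nnegrE// (le_trans rho0).
  have -> : (1 / 4 / Num.sqrt (L / mu)) ^+ 2 = mu / L / 16.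
    have -> : (1 / 4 / Num.sqrt (L / mu)) ^+ 2 = 1 / 16 / Num.sqrt (L / mu) ^+ 2.
      by field; rewrite gt_eqF.
    rewrite sqr_sqrtr; first by field; rewrite !gt_eqF.
    by rewrite ltW// divr_gt0.
  move=> h; have := ler_wpM2l (ltW L0) h.
  have -> : L * (mu / L / 16) = mu / 16 by field; rewrite gt_eqF.
  lra.
have Egain : d%:R * (E1 + E3) / r t ^+ 2 = d%:R * (E1 / r t ^+ 2 + E3 / r t ^+ 2).
  by field; rewrite gt_eqF.
rewrite Egain.
apply: (drift_lower_bound n0 Hf Hxs K0 rho0 Lrho) => [|||i k|i k|i k].
- by rewrite divr_ge0// ltW.
- by rewrite divr_ge0// ltW.
- by move=> i k u v; apply: smoothed_clip_lipschitz => //; exact: ltW.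
- have [[df1 df2 _] hH] := Hfi i.
  have hg : `|grad (f i) xs 0 k| <= M.
    apply: (le_trans (grad_star_coord i k)); rewrite /M lerDl.
    by have := rX0 3%N => r3; nonneg.
  apply: smoothed_clip_linearization => //; [exact: ltW|].
  have hl := grad_coord_lipschitz mu0 muL df2 hH (xbar z t) xs k.
  rewrite -[X in `|X|](subrK (grad (f i) xs 0 k)).
  apply: (le_trans (ler_normD _ _)); rewrite addrC /M lerD ?grad_star_coord//.
  by apply: (le_trans hl); rewrite ler_wpM2l// ltW.
- have hs := grad_star_coord i k.
  have := @smoothed_clip_linearization _ _ _ _ _ _ _ _ (ltW p0) e0 (xi_abs t i k) cstar
    (grad (f i) xs 0 k) 0 hs.
  rewrite normr0 => /(_ c0); rewrite (smoothed_clip0 (ltW p0) e0 (@xi_odd t i k)) !subr0.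
  move=> h; apply: (le_trans h); rewrite -/(gain t) -mulrA ler_wpM2l ?(ltW K0)//.
  apply: (@le_trans _ _ ((3 * cstar ^+ 2 / eps t + 2 * sigma / Num.sqrt (eps t)) * cstar)).
    by apply: ler_wpM2l => //; nonneg.
  rewrite mulrDl /E3 [leRHS]mulrDl; apply: lerD.
    have -> : 3 * cstar ^+ 2 / eps t * cstar = 3 * cstar ^+ 3 / tau / r t ^+ 6.
      by rewrite /smoothing; field; rewrite !gt_eqF.
    apply: ler_wpM2l; first by nonneg.
    by rewrite lef_pV2 ?posrE// ler_weXn2l// scale_ge1.
  rewrite sqrt_smoothing.
  have -> : 2 * sigma / (Num.sqrt tau * r t ^+ 3) * cstar =
      2 * sigma * cstar / Num.sqrt tau / r t ^+ 3 by field; rewrite !gt_eqF.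
  apply: ler_wpM2l; first by nonneg.
  by rewrite lef_pV2 ?posrE// ler_weXn2l// scale_ge1.
- have [[df1 df2 _] hH] := Hfi i.
  rewrite residual_coord addrAC; apply: (le_trans (ler_normB _ _)).
  rewrite /E1 mulrDl; apply: lerD.
    apply: (le_trans (grad_coord_lipschitz mu0 muL df2 hH _ _ k)).
    rewrite -mulrA ler_wpM2l ?(ltW L0)// -mulrA; apply: norm2_rV_le.
      by rewrite divr_ge0// ltW.
    move=> j; rewrite mxE [X in _ + X]mxE.
    exact: cons.
  apply: (le_trans (@momentum_decay R n d f W cphi tau ceta cbeta x0 cphi0 tau0 cbeta01 z t i k)).
  apply: ler_wpM2l; first by nonneg.
  by rewrite lef_pV2 ?posrE// ler_weXn2l// scale_ge1.
Unshelve. all: by end_near. Qed.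
End DriftNear.

(** * Decay of the mean squared error *)

Section Energy.
Context {R : realType} {n d : nat} {dT : measure_display} {T : measurableType dT}.
Variables (mu L cstar sigma : R) (f : 'I_n -> 'rV[R]_d -> R) (xs : 'rV[R]_d)
  (P : probability T R) (xi : nat -> 'I_n -> 'I_d -> {RV P >-> R})
  (W : 'M[R]_n) (cphi tau ceta cbeta : R) (x0 : 'rV[R]_d).
Hypotheses (n0 : (0 < n)%N) (d0 : (0 < d)%N) (Hf : function_assumption mu L f)
  (Hxs : is_argmin (average f) xs) (Hcs : heterogeneity_assumption cstar f xs)
  (W1 : W *m const_mx 1 = const_mx 1 :> 'cV[R]_n)
  (oneW : const_mx 1 *m W = const_mx 1 :> 'rV[R]_n)
  (lam : 0 <= opnorm2 (W - averaging) < 1)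
  (cphi0 : 0 < cphi) (tau0 : 0 < tau) (ceta0 : 0 < ceta) (cbeta01 : 0 <= cbeta < 1)
  (sigma0 : 0 < sigma).
Hypothesis ind : mutually_independent P (step_sigma_algebra xi).
Hypothesis xi_abs : forall t i k, P.-integrable setT (fun w => `|xi t i k w|%:E) /\
  \int[P]_w `|xi t i k w| <= sigma.
Hypothesis xi_odd : forall t i k (h : R -> R) (M : R), measurable_fun setT h ->
  (forall u, `|h u| <= M) -> (forall u, h (- u) = - h u) -> \int[P]_w h (xi t i k w) = 0.
Hypothesis window :
  972 * (L * (Num.sqrt d%:R * ceta * cphi)) ^+ 2 / tau <= 1 / 5 / Num.sqrt (L / mu).

Local Notation r := (@scale R).
Local Notation phi := (clip_level cphi).
Local Notation eps := (smoothing tau).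
Local Notation eta := (step_size ceta).
Local Notation beta := (momentum_weight cbeta).
Local Notation X := (iterate f W cphi tau ceta cbeta x0).
Local Notation m := (momentum f W cphi tau ceta cbeta x0).
Local Notation resid := (residual f W cphi tau ceta cbeta x0).
Local Notation xbar := (mean_iterate f W cphi tau ceta cbeta x0).
Local Notation mbar := (mean_momentum f W cphi tau ceta cbeta x0).
Local Notation Q := (momentum_const cphi cbeta).
Local Notation psi := (mean_clip xi cphi tau).
Local Notation gain := (gain cphi tau).

Definition path w : nat -> 'I_n -> 'rV[R]_d := fun s j => \row_k xi s j k w.
Definition mean_error w t : 'rV[R]_d := xbar (path w) t - xs.
Definition energy t : R := \int[P]_w norm2 (mean_error w t) ^+ 2.

Let Q0 : 0 < Q := momentum_const_gt0 cphi0 cbeta01.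
Let dgrad i x : differentiable (grad (f i)) x.
Proof. by have [_ _ /(_ i)[[_ h _] _]] := Hf. Qed.

Section Measurability.
Context {d' : measure_display} {S : measurableType d'} (g : S -> T) (t : nat).
Hypothesis mxi : forall s i k, (s < t)%N -> measurable_fun setT (fun w => xi s i k (g w)).

Lemma measurable_state :
  [/\ forall i k, measurable_fun setT (fun w => X (path (g w)) t i 0 k),
      forall k, measurable_fun setT (fun w => mean_error (g w) t 0 k) &
      forall i k, measurable_fun setT (fun w => resid (path (g w)) t i 0 k)].
Proof.
have [mX mm] := @measurable_iterate_momentum R n d f W cphi tau ceta cbeta x0
  dgrad tau0 _ S (fun s i k w => xi s i k (g w)) t mxi t (leqnn t).
split=> // [k|i k].
  under eq_fun do rewrite /mean_error mxE [X in X + _]mxE summxE.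
  apply: measurable_funD; last exact: measurable_cst.
  apply: measurable_funM; first exact: measurable_cst.
  exact: measurable_sum.
under eq_fun do rewrite residual_coord.
apply: measurable_funB => //.
pose h (y : 'rV[R]_d) : R := grad (f i) y 0 k.
have ch : continuous h by exact: continuous_grad_coord.
have := @measurable_fun_continuous_rV R _ S d h (fun w => X (path (g w)) t i).
by move=> /(_ ch (mX i)).
Qed.
End Measurability.

Let mxi t s i k : (s < t)%N -> measurable_fun setT (fun w : T => xi s i k w).
Proof. by move=> _; exact: measurable_funPT. Qed.

Lemma mean_error_le t : exists B, forall w, norm2 (mean_error w t) <= B.
Proof.
have [B hB] := @mean_error_bounded R n d f W cphi tau ceta cbeta x0 xs n0 cphi0 tau0
  ceta0 cbeta01 oneW t.
by exists B => w; exact: hB.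
Qed.

Lemma bounded_measurable_mean_error t k : bounded_measurable (fun w => mean_error w t 0 k).
Proof.
have [_ my _] := measurable_state (@mxi t).
split; first exact: my.
have [B hB] := mean_error_le t; exists B => w.
by apply: le_trans (hB w); exact: entry_le_norm2.
Qed.

Lemma bounded_measurable_energy t : bounded_measurable (fun w => norm2 (mean_error w t) ^+ 2).
Proof.
under eq_fun do rewrite norm2_sqr.
by apply: bounded_measurable_sum => k; apply: bounded_measurableM; exact: bounded_measurable_mean_error.
Qed.

Lemma mean_clip_bound t i k a : `|psi t i k a| <= phi t.
Proof.
have p0 := clip_level_gt0 cphi0 t; have e0 := smoothing_gt0 tau0 t.
rewrite -[leRHS](Rintegral_probability_cst P); apply: normr_expectation_le => [||w].
- apply: bounded_measurable_sclip => //; first exact: ltW.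
  by apply: measurable_funD; [exact: measurable_cst|exact: measurable_funPT].
- exact/bounded_measurable_integrable/bounded_measurable_cst.
- by apply: sclip_bound => //; exact: ltW.
Qed.

Lemma lipschitz_continuous (h : R -> R) (K : R) : 0 < K ->
  (forall a b, `|h a - h b| <= K * `|a - b|) -> continuous h.
Proof.
move=> K0 hK a; apply/cvgrPdist_le => e e0; near=> b.
apply: (le_trans (hK a b)); rewrite -ler_pdivlMl//.
by near: b; apply: cvgr_dist_le; [exact: cvg_id|rewrite mulr_gt0// invr_gt0].
Unshelve. all: by end_near. Qed.

Lemma measurable_mean_clip t i k : measurable_fun setT (psi t i k).
Proof.
apply: continuous_measurable_fun; apply: (lipschitz_continuous (gain_gt0 cphi0 tau0 t)).
move=> a b.
exact: (smoothed_clip_lipschitz (xi t i k) (ltW (clip_level_gt0 cphi0 t)) (smoothing_gt0 tau0 t)).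
Qed.

Lemma bounded_measurable_drift t i k : bounded_measurable
  (fun w => mean_error w t 0 k * psi t i k (resid (path w) t i 0 k)).
Proof.
apply: bounded_measurableM; first exact: bounded_measurable_mean_error.
have [_ _ mr] := measurable_state (@mxi t).
split; first by apply: measurableT_comp; [exact: measurable_mean_clip|exact: mr].
by exists (phi t) => w; exact: mean_clip_bound.
Qed.

Lemma bounded_measurable_noisy_drift t i k : bounded_measurable
  (fun w => mean_error w t 0 k * sclip (phi t) (eps t) (resid (path w) t i 0 k + xi t i k w)).
Proof.
apply: bounded_measurableM; first exact: bounded_measurable_mean_error.
have [_ _ mr] := measurable_state (@mxi t).
apply: bounded_measurable_sclip; [exact/ltW/clip_level_gt0|exact: smoothing_gt0|].
by apply: measurable_funD; [exact: mr|exact: measurable_funPT].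
Qed.

(** The error and the residual at step t depend on the earlier noise only. *)
Lemma expectation_noisy_drift t i k :
  \int[P]_w (mean_error w t 0 k * sclip (phi t) (eps t) (resid (path w) t i 0 k + xi t i k w)) =
  \int[P]_w (mean_error w t 0 k * psi t i k (resid (path w) t i 0 k)).
Proof.
have [_ my mr] := measurable_state (@mxi t).
have [_ [M hM]] := bounded_measurable_mean_error t k.
have mpast s j l : (s < t)%N -> measurable_fun setT (fun w : pastType xi t => xi s j l w).
  exact: measurable_past.
have [_ my' mr'] := measurable_state mpast.
apply: (@sclip_decoupling R n d dT T P xi ind t i k (phi t) (eps t) M) => //.
- exact/ltW/clip_level_gt0.
- exact: smoothing_gt0.
Qed.

Lemma mean_momentumS w t k : mbar (path w) t.+1 0 k = beta t * mbar (path w) t 0 k +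
  (1 - beta t) * (n%:R^-1 * \sum_i sclip (phi t) (eps t) (resid (path w) t i 0 k + xi t i k w)).
Proof.
rewrite mxE summxE [mbar _ _ _ _]mxE summxE.
rewrite (mulrCA (beta t)) (mulrCA (1 - beta t)) -mulrDr; congr (_ * _).
rewrite !mulr_sumr -big_split; apply: eq_bigr => i _ /=.
by rewrite momentumS_coord [X in sclip _ _ (_ + X)]mxE.
Qed.

Lemma dot_mean_momentumS w t : dot (mean_error w t) (mbar (path w) t.+1) =
  beta t * dot (mean_error w t) (mbar (path w) t) + (1 - beta t) * (n%:R^-1 * \sum_i \sum_k
    mean_error w t 0 k * sclip (phi t) (eps t) (resid (path w) t i 0 k + xi t i k w)).
Proof.
rewrite exchange_big /dot !mulr_sumr -big_split; apply: eq_bigr => k _ /=.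
rewrite mean_momentumS mulrDr mulrCA; congr (_ + _).
rewrite mulrCA; congr (_ * _); rewrite mulrCA; congr (_ * _).
by rewrite mulr_sumr.
Qed.

Lemma energyS w t : norm2 (mean_error w t.+1) ^+ 2 = norm2 (mean_error w t) ^+ 2
  - 2 * eta t * dot (mean_error w t) (mbar (path w) t.+1)
  + eta t ^+ 2 * norm2 (mbar (path w) t.+1) ^+ 2.
Proof.
rewrite {1}/mean_error (@mean_iterateS R n d f W cphi tau ceta cbeta x0 n0 oneW).
rewrite addrAC -/(mean_error w t); move: (mean_error w t) (mbar (path w) t.+1) => y v.
rewrite !norm2_sqr !dotE (dotC v y).
by ring.
Qed.

Lemma mean_momentumS_norm w t : norm2 (mbar (path w) t.+1) <= Num.sqrt d%:R * (Q / r t ^+ 5).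
Proof.
have r0 := scale_gt0 (R := R) t.
apply: norm2_rV_le => [|k]; first by apply: mulr_ge0; nonneg.
by apply: mean_momentum_entry => // i l; exact: momentumS_bound.
Qed.

Lemma mean_momentum_norm w t : norm2 (mbar (path w) t) <= Num.sqrt d%:R * (2 * Q / r t ^+ 5).
Proof.
have r0 := scale_gt0 (R := R) t.
apply: norm2_rV_le => [|k]; first by apply: mulr_ge0; nonneg.
by apply: mean_momentum_entry => // i l; exact: momentum_decay.
Qed.

Let k0 : R := ceta * cphi / Num.sqrt tau.

(** The gain times the step size is exactly k0 / (t+1). Of the resulting
    contraction k0 mu / (2 (t+1)), half is spent on beta <= 1/4 and on absorbing
    the terms linear in the error by Young's inequality; what is left over, like
    the squared step, is O((t+1)^(-7/5)). *)
Lemma averaged_step_near : exists C, 0 <= C /\ \forall t \near \oo, forall w,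
  norm2 (mean_error w t) ^+ 2
  - 2 * eta t * (beta t * dot (mean_error w t) (mbar (path w) t) +
      (1 - beta t) * (n%:R^-1 * \sum_i \sum_k
        mean_error w t 0 k * psi t i k (resid (path w) t i 0 k)))
  + eta t ^+ 2 * (Num.sqrt d%:R * (Q / r t ^+ 5)) ^+ 2 <=
  (1 - k0 * (mu / 4) / r t ^+ 10) * norm2 (mean_error w t) ^+ 2 + C / r t ^+ 14.
Proof.
have [mu0 _ _] := Hf.
have st0 : 0 < Num.sqrt tau by rewrite sqrtr_gt0.
have k00 : 0 < k0 by rewrite divr_gt0// mulr_gt0.
have [cb0 cb1] := andP cbeta01.
have [C3 [C30 hC3]] := @drift_near R n d _ T mu L cstar sigma f xs P xi W cphi tau ceta
  cbeta x0 n0 d0 Hf Hxs Hcs W1 oneW lam cphi0 tau0 ceta0 cbeta01 sigma0 xi_abs xi_odd window.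
pose C2 := ceta * cbeta * Num.sqrt d%:R * (2 * Q) / k0.
pose C := C2 + C3.
pose D := Num.sqrt d%:R * Q.
exists (k0 * (8 / mu) * C ^+ 2 + ceta ^+ 2 * D ^+ 2); split.
  by apply: addr_ge0; nonneg.
near=> t.
have drift : forall z, gain t * (mu / 4 * norm2 (xbar z t - xs) ^+ 2 -
    C3 / r t ^+ 2 * norm2 (xbar z t - xs)) <=
    n%:R^-1 * \sum_i \sum_k (xbar z t - xs) 0 k * psi t i k (resid z t i 0 k) by near: t.
have r5 : 4 <= r t ^+ 5 by near: t; exact: scaleX_near_ge.
move=> w; set y := mean_error w t; set N := norm2 y.
set s := n%:R^-1 * _.
have hs : gain t * (mu / 4 * N ^+ 2 - C3 / r t ^+ 2 * N) <= s := drift (path w).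
have r0 := scale_gt0 (R := R) t.
have N0 : 0 <= N := norm2_ge0 y.
have b0 : 0 <= beta t := momentum_weight_ge0 cbeta01 t.
have b4 : beta t <= 1 / 4.
  rewrite ler_pdivrMr ?exprn_gt0//; lra.
have e0 : 0 < eta t := step_size_gt0 ceta0 t.
have hdot : - (N * (Num.sqrt d%:R * (2 * Q / r t ^+ 5))) <= dot y (mbar (path w) t).
  rewrite lerNl -dotNl; apply: (le_trans (dot_le_norm2 _ _)); rewrite norm2N.
  by apply: ler_wpM2l => //; exact: mean_momentum_norm.
have keta : eta t * gain t = k0 / r t ^+ 10 := @eta_gain R cphi tau ceta tau0 t.
pose q := (r t ^+ 10)^-1.
have q0 : 0 <= q by rewrite /q; nonneg.
pose p := (r t ^+ 2)^-1.
have p0 : 0 <= p by rewrite /p; nonneg.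
have h1 : - (k0 * q * (C2 * p * N)) <= eta t * (beta t * dot y (mbar (path w) t)).
  have : eta t * beta t * - (N * (Num.sqrt d%:R * (2 * Q / r t ^+ 5))) <=
         eta t * beta t * dot y (mbar (path w) t).
    by apply: ler_wpM2l => //; apply: mulr_ge0 => //; exact: ltW.
  move=> h; rewrite [leRHS]mulrA; apply: le_trans _ h.
  rewrite le_eqVlt; apply/orP; left; apply/eqP.
  by rewrite /q /p /C2 /step_size /momentum_weight; field; rewrite !gt_eqF.
have h2 : k0 * q * (mu / 4 * N ^+ 2 - C3 * p * N) <= eta t * s.
  have : eta t * (gain t * (mu / 4 * N ^+ 2 - C3 / r t ^+ 2 * N)) <= eta t * s.
    by rewrite ler_pM2l.
  by rewrite mulrA keta.
have h3 : (1 - beta t) * (k0 * q * (mu / 4 * N ^+ 2 - C3 * p * N)) <= (1 - beta t) * (eta t * s).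
  by rewrite ler_wpM2l//; lra.
have kq0 : 0 <= k0 * q by rewrite mulr_ge0// ltW.
have h4 : 3 / 16 * mu * N ^+ 2 - C3 * p * N <= (1 - beta t) * (mu / 4 * N ^+ 2 - C3 * p * N).
  have a1 : 0 <= mu * N ^+ 2 by apply: mulr_ge0; [exact: ltW|exact: sqr_ge0].
  have a2 : 0 <= C3 * p * N by nonneg.
  have : beta t * (mu * N ^+ 2) <= 1 / 4 * (mu * N ^+ 2) by rewrite ler_wpM2r.
  have : 0 <= beta t * (C3 * p * N) by rewrite mulr_ge0.
  lra.
have h5 := ler_wpM2l kq0 h4.
have young : 2 * (C * p * N) <= mu / 8 * N ^+ 2 + 8 / mu * (C * p) ^+ 2.
  have : 0 <= 8 / mu * (mu / 8 * N - C * p) ^+ 2.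
    by apply: mulr_ge0; [apply: divr_ge0 => //; exact: ltW|exact: sqr_ge0].
  have -> : 8 / mu * (mu / 8 * N - C * p) ^+ 2 =
     mu / 8 * N ^+ 2 - 2 * (C * p * N) + 8 / mu * (C * p) ^+ 2 by field; rewrite gt_eqF.
  lra.
have h6 := ler_wpM2l kq0 young.
have -> : (k0 * (8 / mu) * C ^+ 2 + ceta ^+ 2 * D ^+ 2) / r t ^+ 14 =
    k0 * q * (8 / mu * (C * p) ^+ 2) + eta t ^+ 2 * (Num.sqrt d%:R * (Q / r t ^+ 5)) ^+ 2.
  by rewrite /D /q /p /step_size; field; rewrite !gt_eqF.
have -> : (1 - k0 * (mu / 4) / r t ^+ 10) * N ^+ 2 = N ^+ 2 - k0 * q * (mu / 4 * N ^+ 2).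
  by rewrite /q; ring.
rewrite addrA lerD2r.
have -> : 2 * eta t * (beta t * dot y (mbar (path w) t) + (1 - beta t) * s) =
  2 * (eta t * (beta t * dot y (mbar (path w) t)) + (1 - beta t) * (eta t * s)) by ring.
rewrite /C in h6 *; lra.
Unshelve. all: by end_near. Qed.

Lemma bounded_measurable_dot_momentum t :
  bounded_measurable (fun w => dot (mean_error w t) (mbar (path w) t)).
Proof.
have [_ mm] := @measurable_iterate_momentum R n d f W cphi tau ceta cbeta x0
  dgrad tau0 _ T (fun s i k w => xi s i k w) t (@mxi t) t (leqnn t).
apply: bounded_measurable_sum => k; apply: bounded_measurableM; first exact: bounded_measurable_mean_error.
under eq_fun do rewrite mxE summxE.
apply: bounded_measurableZ; apply: bounded_measurable_sum => i.
by split; [exact: mm|exists Q => w; exact: momentum_bound].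
Qed.

(** The noise enters the expected squared error of the next step only through the
    inner product with the current error, where it may be averaged out, and
    through the squared step, which clipping bounds surely. *)
Lemma energy_recursion : exists C, 0 <= C /\ \forall t \near \oo,
  energy t.+1 <= (1 - k0 * (mu / 4) / r t ^+ 10) * energy t + C / r t ^+ 14.
Proof.
have [C [C0 hC]] := averaged_step_near; exists C; split=> //.
near=> t.
have step : forall w, norm2 (mean_error w t) ^+ 2
  - 2 * eta t * (beta t * dot (mean_error w t) (mbar (path w) t) +
      (1 - beta t) * (n%:R^-1 * \sum_i \sum_k
        mean_error w t 0 k * psi t i k (resid (path w) t i 0 k)))
  + eta t ^+ 2 * (Num.sqrt d%:R * (Q / r t ^+ 5)) ^+ 2 <=
  (1 - k0 * (mu / 4) / r t ^+ 10) * norm2 (mean_error w t) ^+ 2 + C / r t ^+ 14 by near: t.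
have r0 := scale_gt0 (R := R) t.
have e0 : 0 < eta t := step_size_gt0 ceta0 t.
pose A w := norm2 (mean_error w t) ^+ 2 +
   (- (2 * eta t * beta t) * dot (mean_error w t) (mbar (path w) t) +
    eta t ^+ 2 * (Num.sqrt d%:R * (Q / r t ^+ 5)) ^+ 2).
pose c := - (2 * eta t * (1 - beta t) * n%:R^-1).
pose Sn w := \sum_i \sum_k mean_error w t 0 k *
    sclip (phi t) (eps t) (resid (path w) t i 0 k + xi t i k w).
pose Sp w := \sum_i \sum_k mean_error w t 0 k * psi t i k (resid (path w) t i 0 k).
have bA : bounded_measurable A.
  apply: bounded_measurableD; first exact: bounded_measurable_energy.
  apply: bounded_measurableD; last exact: bounded_measurable_cst.
  by apply: bounded_measurableZ; exact: bounded_measurable_dot_momentum.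
have bSn : bounded_measurable Sn.
  by do 2 (apply: bounded_measurable_sum => ?); exact: bounded_measurable_noisy_drift.
have bSp : bounded_measurable Sp.
  by do 2 (apply: bounded_measurable_sum => ?); exact: bounded_measurable_drift.
have ESnp : \int[P]_w Sn w = \int[P]_w Sp w.
  rewrite /Sn /Sp !bounded_expectation_sum; last 2 first.
  - by move=> i; apply: bounded_measurable_sum => k; exact: bounded_measurable_drift.
  - by move=> i; apply: bounded_measurable_sum => k; exact: bounded_measurable_noisy_drift.
  apply: eq_bigr => i _; rewrite !bounded_expectation_sum; last 2 first.
  - by move=> k; exact: bounded_measurable_drift.
  - by move=> k; exact: bounded_measurable_noisy_drift.
  by apply: eq_bigr => k _; exact: expectation_noisy_drift.
have le1 : energy t.+1 <= \int[P]_w (A w + c * Sn w).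
  apply: bounded_expectation_le => [||w]; first exact: bounded_measurable_energy.
    by apply: bounded_measurableD => //; exact: bounded_measurableZ.
  rewrite energyS dot_mean_momentumS -/(Sn w) /A /c.
  have : eta t ^+ 2 * norm2 (mbar (path w) t.+1) ^+ 2 <=
         eta t ^+ 2 * (Num.sqrt d%:R * (Q / r t ^+ 5)) ^+ 2.
    apply: ler_wpM2l; first exact: sqr_ge0.
    rewrite lerXn2r ?nnegrE ?norm2_ge0 ?mean_momentumS_norm//.
    by apply: le_trans (mean_momentumS_norm w t); exact: norm2_ge0.
  lra.
apply: (le_trans le1).
have bcSn := bounded_measurableZ c bSn; have bcSp := bounded_measurableZ c bSp.
rewrite (bounded_expectationD P bA bcSn) (bounded_expectationZ P c bSn) ESnp.
rewrite -(bounded_expectationZ P c bSp) -(bounded_expectationD P bA bcSp).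
rewrite /energy -bounded_expectationZ; last exact: bounded_measurable_energy.
rewrite -[X in _ + X](Rintegral_probability_cst P) -bounded_expectationD; last 2 first.
- by apply: bounded_measurableZ; exact: bounded_measurable_energy.
- exact: bounded_measurable_cst.
apply: bounded_expectation_le => [||w].
- by apply: bounded_measurableD => //; exact: bounded_measurableZ.
- apply: bounded_measurableD; last exact: bounded_measurable_cst.
  by apply: bounded_measurableZ; exact: bounded_measurable_energy.
apply: le_trans (step w); rewrite -/(Sp w) /A /c.
rewrite le_eqVlt; apply/orP; left; apply/eqP; ring.
Unshelve. all: by end_near. Qed.

Lemma norm2_sqrD_le (u v : 'rV[R]_d) :
  norm2 (u + v) ^+ 2 <= 2 * norm2 u ^+ 2 + 2 * norm2 v ^+ 2.
Proof.
rewrite !norm2_sqr !dotE (dotC v u).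
by have := @dot_young R d 1 u v ltr01; rewrite invr1; lra.
Qed.

(** A node differs from the average by O(t^(-1/5)), whose square is of the order of
    the limiting rate 2/5. *)
Lemma node_error_near : exists C, 0 <= C /\ \forall t \near \oo, forall i,
  bounded_measurable (fun w => norm2 (X (path w) t i - xs) ^+ 2) /\
  \int[P]_w norm2 (X (path w) t i - xs) ^+ 2 <= 2 * energy t + C / r t ^+ 4.
Proof.
have [C1 [C10 hC1]] := @consensus_near R n d f W cphi tau ceta cbeta x0 n0 cphi0 tau0
  ceta0 cbeta01 W1 oneW lam.
exists (2 * (Num.sqrt d%:R * C1) ^+ 2); split; first by nonneg.
near=> t => i.
have cons : forall z i k, `|X z t i 0 k - xbar z t 0 k| <= C1 / r t ^+ 2 by near: t.
have r0 := scale_gt0 (R := R) t.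
pose D w := X (path w) t i - xbar (path w) t.
have XD w : X (path w) t i - xs = mean_error w t + D w.
  by rewrite /mean_error /D [RHS]addrC addrA subrK.
have Dk w k : D w 0 k = X (path w) t i 0 k - xbar (path w) t 0 k.
  by rewrite mxE [X in _ + X]mxE.
have nD w : norm2 (D w) <= Num.sqrt d%:R * (C1 / r t ^+ 2).
  apply: norm2_rV_le => [|k]; first by apply: divr_ge0 => //; nonneg.
  by rewrite Dk.
have [mX my _] := measurable_state (@mxi t).
have bX : bounded_measurable (fun w => norm2 (X (path w) t i - xs) ^+ 2).
  under eq_fun do rewrite norm2_sqr.
  have [B hB] := mean_error_le t.
  suff bk k : bounded_measurable (fun w => (X (path w) t i - xs) 0 k).
    by apply: bounded_measurable_sum => k; exact: bounded_measurableM.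
  split.
    under eq_fun do rewrite mxE.
    by apply: measurable_funD; [exact: mX|exact: measurable_cst].
  exists (B + Num.sqrt d%:R * (C1 / r t ^+ 2)) => w.
  apply: (le_trans (entry_le_norm2 _ _ _)); rewrite XD.
  by apply: (le_trans (norm2D_rV _ _)); rewrite lerD.
split=> //.
have -> : 2 * energy t + 2 * (Num.sqrt d%:R * C1) ^+ 2 / r t ^+ 4 =
    \int[P]_w (2 * norm2 (mean_error w t) ^+ 2 + 2 * (Num.sqrt d%:R * (C1 / r t ^+ 2)) ^+ 2).
  rewrite (bounded_expectationD P (bounded_measurableZ 2 (bounded_measurable_energy t)) (bounded_measurable_cst _)).
  rewrite (bounded_expectationZ P 2 (bounded_measurable_energy t)) Rintegral_probability_cst; congr (_ + _).
  by field; rewrite gt_eqF.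
apply: bounded_expectation_le => // [|w].
  by apply: bounded_measurableD; [apply: bounded_measurableZ; exact: bounded_measurable_energy|
    exact: bounded_measurable_cst].
rewrite XD; apply: (le_trans (norm2_sqrD_le _ _)); rewrite lerD2l ler_wpM2l//.
by rewrite lerXn2r ?nnegrE ?norm2_ge0// (le_trans (norm2_ge0 (D w))).
Unshelve. all: by end_near. Qed.

Lemma node_error_rate (i : 'I_n) (delta : R) : 0 < delta < Num.min (k0 * (mu / 4)) (2 / 5) ->
  ((t.+1%:R `^ delta)%:E * 'E_P[fun w => (norm2 (X (path w) t i - xs) ^+ 2)%R])%E
    @[t --> \oo] --> 0%E.
Proof.
move=> hdelta; have /andP[delta0] := hdelta; rewrite lt_min => /andP[_ delta25].
have [C [C0 hC]] := energy_recursion; have [D [D0 hD]] := node_error_near.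
have en0 t : 0 <= energy t by apply: Rintegral_ge0 => w _; exact: sqr_ge0.
have he := rate_recursion en0 C0 hdelta hC.
pose v t := \int[P]_w norm2 (X (path w) t i - xs) ^+ 2.
have hv : t.+1%:R `^ delta * v t @[t --> \oo] --> 0.
  apply: (@squeeze_cvgr _ _ _ _ (fun=> 0)
    (fun t => 2 * (t.+1%:R `^ delta * energy t) + D * t.+1%:R `^ (- (2 / 5 - delta)))).
  - near=> t; apply/andP; split.
      by rewrite mulr_ge0 ?powR_ge0//; apply: Rintegral_ge0 => w _; exact: sqr_ge0.
    have hvt : v t <= 2 * energy t + D / r t ^+ 4.
      have H : forall i, bounded_measurable (fun w => norm2 (X (path w) t i - xs) ^+ 2) /\
        \int[P]_w norm2 (X (path w) t i - xs) ^+ 2 <= 2 * energy t + D / r t ^+ 4 by near: t.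
      by have [_] := H i.
    apply: (@le_trans _ _ (t.+1%:R `^ delta * (2 * energy t + D / r t ^+ 4))).
      by rewrite ler_wpM2l ?powR_ge0.
    have -> : t.+1%:R `^ (- (2 / 5 - delta)) = t.+1%:R `^ delta / r t ^+ 4 :> R.
      rewrite -powR_scale -powRN -powRD; last by rewrite pnatr_eq0 /= implybT.
      by congr (_ `^ _); field.
    by rewrite le_eqVlt; apply/orP; left; apply/eqP; ring.
  - exact: cvg_cst.
  - rewrite -[X in _ --> X](addr0 0) -{1}(mulr0 2) -[X in _ --> _ + X](mulr0 D).
    apply: cvgD; apply: cvgMl_tmp => //.
    by apply: powRN_cvg0; lra.
have hv' : (t.+1%:R `^ delta * v t)%:E @[t --> \oo] --> 0%E by apply/cvg_EFin; [near=> t|].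
apply: cvg_trans hv'; apply: near_eq_cvg; near=> t.
have H : forall i, bounded_measurable (fun w => norm2 (X (path w) t i - xs) ^+ 2) /\
  \int[P]_w norm2 (X (path w) t i - xs) ^+ 2 <= 2 * energy t + D / r t ^+ 4 by near: t.
have [bX _] := H i; rewrite EFinM; congr (_ * _)%E.
rewrite unlock /v /Rintegral fineK//.
by apply: integrable_fin_num => //; exact: bounded_measurable_integrable.
Unshelve. all: by end_near. Qed.
End Energy.

(** * Convergence rate *)

Unset Implicit Arguments.

Theorem theorem1 (R : realType) :
  exists a1 a2 b1 b2 c0 : R,
    [/\ 0 < a1 <= a2, 0 < b1 <= b2 & 0 < c0] /\
    forall (n d : nat) (mu L cstar sigma : R)
      (f : 'I_n -> 'rV[R]_d -> R) (xs : 'rV[R]_d)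
      (dT : measure_display) (T : measurableType dT) (P : probability T R)
      (xi : nat -> 'I_n -> 'I_d -> {RV P >-> R})
      (W : 'M[R]_n) (link : rel 'I_n)
      (cphi tau ceta cbeta : R) (x0 : 'rV[R]_d),
    (0 < n)%N -> (0 < d)%N ->
    function_assumption mu L f ->
    is_argmin (average f) xs ->
    heterogeneity_assumption cstar f xs ->
    noise_assumption sigma xi ->
    network_assumption W link ->
    0 < cphi -> 0 < tau -> 0 < ceta -> 0 <= cbeta < 1 ->
    a1 * (sigma ^+ 2 / mu ^+ 2) <= ceta ^+ 2 * cphi ^+ 2
      <= a2 * (sigma ^+ 2 / mu ^+ 2) ->
    b1 * d%:R * sigma ^+ 2 * (L / mu) `^ (5 / 2) <= tau
      <= b2 * d%:R * sigma ^+ 2 * (L / mu) `^ (5 / 2) ->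
    let phi t := cphi / Num.sqrt t.+1%:R in
    let eps t := tau * t.+1%:R `^ (3 / 5) in
    let beta t := cbeta / Num.sqrt t.+1%:R in
    let eta t := ceta / t.+1%:R `^ (1 / 5) in
    let x t i w := (sclip_ef_network f W phi eps beta eta x0
                      (fun s j => \row_k xi s j k w) t).1 i in
    exists cs : R, c0 * d%:R `^ (- (1 / 2)) * (L / mu) `^ (- (5 / 4)) <= cs /\
      forall (i : 'I_n) (delta : R), 0 < delta < Num.min cs (2 / 5) ->
        ((t.+1%:R `^ delta)%:E * 'E_P[fun w => (norm2 (x t i w - xs) ^+ 2)%R])%E
          @[t --> \oo] --> 0%E.
Proof.
exists (1 / 100), (1 / 25), 200, 400, (1 / 800); split; first by split; [lra|lra|lra].
move=> n d mu L cstar sigma f xs dT T P xi W link cphi tau ceta cbeta x0 n0 d0 Hf Hxs Hcs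
  Hnoise [_ _ _ [W1 oneW] lam] cphi0 tau0 ceta0 cbeta01 Ha Hb.
have [mu0 muL _] := Hf.
have [sigma0 ind [p [mp p0 pN dens ps]]] := Hnoise.
have [window rate] := parameter_window mu0 muL sigma0 d0 cphi0 tau0 ceta0 Ha Hb.
move=> phi eps beta eta x.
have phiE : phi = clip_level cphi by apply/funext => t; rewrite /phi sqrt_scale.
have epsE : eps = smoothing tau.
  apply/funext => t; rewrite /eps /smoothing -powR_scale; congr (_ * _ `^ _).
  by field.
have betaE : beta = momentum_weight cbeta by apply/funext => t; rewrite /beta sqrt_scale.
have etaE : eta = step_size ceta.
  apply/funext => t; rewrite /eta /step_size -powR_scale; congr (_ / _ `^ _).
  by field.
exists (1 / 800 * d%:R `^ (- (1 / 2)) * (L / mu) `^ (- (5 / 4))); split=> // i delta.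
move=> /andP[delta0]; rewrite lt_min => /andP[dc d25].
rewrite /x phiE epsE betaE etaE.
have xi_abs t j k := expectation_normr_density mp p0 (dens t j k) ps.
have xi_odd t j k h M mh hM hN :=
  @expectation_odd R dT T P (xi t j k) p h M mp p0 (dens t j k) pN mh hM hN.
have hd : 0 < delta < Num.min (ceta * cphi / Num.sqrt tau * (mu / 4)) (2 / 5).
  by rewrite delta0 lt_min d25 andbT (lt_le_trans dc).
exact: (node_error_rate x0 n0 d0 Hf Hxs Hcs W1 oneW lam cphi0 tau0 ceta0 cbeta01 sigma0
  ind xi_abs xi_odd window i hd).
Qed.
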